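(* Let $\mathcal P$ be an additive induced-hereditary hypergraph property. Then $\mathcal P$ has a factorisation $\mathcal P=\mathcal P_1\circ\cdots\circ\mathcal P_n$ into irreducible additive induced-hereditary properties, this factorisation is unique (up to the order of the factors), and the number of factors is exactly $n=dec(\mathcal P)$.
   Context: All hypergraphs are finite, without loops or multiple edges; each edge is an ordered tuple $(v_1,\dots,v_r;c)$ of $r\ge 2$ distinct vertices together with a colour $c$, and isomorphisms must preserve the order and colour of edges. For $U\subseteq V(H)$, $H[U]$ is the hypergraph on $U$ whose edges are those edges of $H$ all of whose vertices lie in $U$; $G\le H$ means $G$ is isomorphic to $H[U]$ for some $U\subseteq V(H)$. A property is a nonempty isomorphism-closed class of hypergraphs; the null hypergraph $K_0=(\emptyset,\emptyset)$ is regarded as belonging to every property. A property is induced-hereditary if $H\in\mathcal P$ and $K\le H$ imply $K\in\mathcal P$, and additive if it is closed under disjoint unions. For properties $\mathcal P_1,\dots,\mathcal P_n$, a $(\mathcal P_1,\dots,\mathcal P_n)$-partition of $H$ is a partition $(V_1,\dots,V_n)$ of $V(H)$ into possibly empty parts with $H[V_i]\in\mathcal P_i$ for all $i$; $\mathcal P_1\circ\cdots\circ\mathcal P_n$ is the class of hypergraphs having such a partition. An additive induced-hereditary property $\mathcal P$ is reducible if $\mathcal P=\mathcal P_1\circ\mathcal P_2$ for some additive induced-hereditary $\mathcal P_1,\mathcal P_2$, and irreducible otherwise. For hypergraphs $G_1,\dots,G_n$ on pairwise disjoint vertex sets, $G_1*\cdots*G_n$ is the set of all hypergraphs $H$ with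 $V(H)=\bigcup_i V(G_i)$ and $H[V(G_i)]=G_i$ for all $i$. $kG$ denotes the disjoint union of $k$ copies of $G$, and $K_1$ the one-vertex hypergraph. A $\mathcal P$-decomposition of $G$ with $n$ parts is a partition $(V_1,\dots,V_n)$ of $V(G)$ into nonempty sets such that $kG[V_1]*\cdots*kG[V_n]\subseteq\mathcal P$ for every positive integer $k$. $dec_{\mathcal P}(G)$ is the maximum number of parts in a $\mathcal P$-decomposition of $G$ (and $0$ if $G\notin\mathcal P$). $G$ is $\mathcal P$-strict if $G\in\mathcal P$ but $G*K_1\not\subseteq\mathcal P$. $dec(\mathcal P)=\min\{dec_{\mathcal P}(G): G\text{ is }\mathcal P\text{-strict}\}$.
   Formalization: P is assumed not to be the class of all hypergraphs (there dec(P) is undefined and no irreducible factorisation exists), and every property is required to contain a hypergraph with at least one vertex (otherwise {K_0} would make everything reducible). *)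

(* Defs.v *)
From HB Require Import structures.
From mathcomp Require Import all_boot.

Set Implicit Arguments.
Unset Strict Implicit.
Unset Printing Implicit Defensive.

(* [edge s c] means that the ordered tuple [s], with the colour [c], is an
   edge.  Edges of different sizes may coexist, and the set of edges is a set of
   pairs (tuple, colour).  [edge_fin] matters only when [C] is infinite. *)
Record hgraph_on (C : eqType) (V : finType) := HGraphOn {
  edge : seq V -> C -> Prop;
  edge_wf : forall s c, edge s c -> 2 <= size s /\ uniq s;
  edge_fin : exists E : seq (seq V * C), forall s c, edge s c -> (s, c) \in E
}.

Record hgraph (C : eqType) := HGraph {
  vert : finType;
  struct :> hgraph_on C vert
}.

Section Constructions.
Variable C : eqType.

Lemma edgeless_wf (V : finType) (s : seq V) (c : C) :
  False -> 2 <= size s /\ uniq s.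
Proof. by []. Qed.

Lemma edgeless_fin (V : finType) :
  exists E : seq (seq V * C), forall s c, False -> (s, c) \in E.
Proof. by exists [::]. Qed.

Definition edgeless (V : finType) : hgraph C :=
  HGraph (HGraphOn (@edgeless_wf V) (edgeless_fin V)).

Definition K0 : hgraph C := edgeless void.
Definition K1 : hgraph C := edgeless unit.

Definition induced_edge (H : hgraph C) (U : {set vert H})
  (s : seq {x | x \in U}) (c : C) : Prop := edge H (map val s) c.

Lemma induced_wf (H : hgraph C) (U : {set vert H}) s c :
  induced_edge (U := U) s c -> 2 <= size s /\ uniq s.
Proof.
by move=> /edge_wf[]; rewrite size_map (map_inj_uniq val_inj).
Qed.

Lemma induced_fin (H : hgraph C) (U : {set vert H}) :
  exists E : seq (seq {x | x \in U} * C),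
    forall s c, induced_edge s c -> (s, c) \in E.
Proof.
have [E HE] := edge_fin H.
exists [seq (pmap insub e.1, e.2) | e <- E] => s c /HE sE.
by apply/mapP; exists (map val s, c) => //=; rewrite (map_pK valK).
Qed.

Definition induced (H : hgraph C) (U : {set vert H}) : hgraph C :=
  HGraph (HGraphOn (@induced_wf H U) (induced_fin U)).

Definition dunion_edge (I : finType) (Gs : I -> hgraph C)
  (s : seq {i : I & vert (Gs i)}) (c : C) : Prop :=
  exists i (t : seq (vert (Gs i))),
    s = map (Tagged (fun j => vert (Gs j))) t /\ edge (Gs i) t c.

Lemma dunion_wf (I : finType) (Gs : I -> hgraph C) s c :
  dunion_edge (Gs := Gs) s c -> 2 <= size s /\ uniq s.
Proof.
move=> [i [t [-> /edge_wf[t2 ut]]]]; rewrite size_map; split=> //.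
rewrite map_inj_uniq // => x y /eqP; rewrite -tag_eqE /tag_eq /= eqxx /=.
by rewrite tagged_asE => /eqP.
Qed.

Lemma dunion_fin (I : finType) (Gs : I -> hgraph C) :
  exists E : seq (seq {i : I & vert (Gs i)} * C),
    forall s c, dunion_edge s c -> (s, c) \in E.
Proof.
have [E HE] := fin_all_exists (fun i => edge_fin (Gs i)).
exists (flatten [seq [seq (map (Tagged (fun j => vert (Gs j))) e.1, e.2)
                      | e <- E i] | i <- enum I]) => s c [i [t [-> /HE tE]]].
apply/flatten_mapP; exists i; first by rewrite mem_enum.
by apply/mapP; exists (t, c).
Qed.

Definition dunion (I : finType) (Gs : I -> hgraph C) : hgraph C :=
  HGraph (HGraphOn (@dunion_wf I Gs) (dunion_fin Gs)).

Definition copies (k : nat) (G : hgraph C) : hgraph C :=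
  dunion (fun _ : 'I_k => G).

Definition iso (G H : hgraph C) : Prop :=
  exists f : vert G -> vert H,
    bijective f /\ forall s c, edge G s c <-> edge H (map f s) c.

Definition ind_sub (G H : hgraph C) : Prop :=
  exists U : {set vert H}, iso G (induced U).

(* [E] is (the edge structure of) a member of the join of the [Gs i], whose
   vertex sets are made disjoint by tagging. *)
Definition in_join (I : finType) (Gs : I -> hgraph C)
  (E : hgraph_on C {i : I & vert (Gs i)}) : Prop :=
  forall i (s : seq (vert (Gs i))) c,
    edge E (map (Tagged (fun j => vert (Gs j))) s) c <-> edge (Gs i) s c.

Definition join_sub (I : finType) (Gs : I -> hgraph C)
  (P : hgraph C -> Prop) : Prop :=
  forall E : hgraph_on C {i : I & vert (Gs i)}, in_join E -> P (HGraph E).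

Definition same_class (P Q : hgraph C -> Prop) : Prop :=
  forall H, P H <-> Q H.

(* Since every property contains [K0], nonemptiness is only meaningful for
   hypergraphs with at least one vertex.  If the class {K0} counted as a
   property, it would be a unit for composition and nothing would be
   irreducible. *)
Definition property (P : hgraph C -> Prop) : Prop :=
  [/\ forall G H, iso G H -> P G -> P H,
      P K0
    & exists H, P H /\ 0 < #|vert H|].

Definition induced_hereditary (P : hgraph C -> Prop) : Prop :=
  forall H K, P H -> ind_sub K H -> P K.

Definition additive (P : hgraph C -> Prop) : Prop :=
  forall (I : finType) (Gs : I -> hgraph C),
    (forall i, P (Gs i)) -> P (dunion Gs).

Definition add_ind_her (P : hgraph C -> Prop) : Prop :=
  [/\ property P, additive P & induced_hereditary P].

Definition is_partition (I V : finType) (Vs : I -> {set V}) : Prop :=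
  (forall i j, i != j -> [disjoint Vs i & Vs j]) /\
  \bigcup_i Vs i = [set: V].

Definition compose (I : finType) (Ps : I -> hgraph C -> Prop)
  (H : hgraph C) : Prop :=
  exists Vs : I -> {set vert H},
    is_partition Vs /\ forall i, Ps i (induced (Vs i)).

Definition compose2 (P1 P2 : hgraph C -> Prop) : hgraph C -> Prop :=
  compose (fun b : bool => if b then P1 else P2).

Definition reducible (P : hgraph C -> Prop) : Prop :=
  exists P1 P2, [/\ add_ind_her P1, add_ind_her P2
                  & same_class P (compose2 P1 P2)].

Definition irreducible (P : hgraph C -> Prop) : Prop :=
  add_ind_her P /\ ~ reducible P.

Definition decomposition (P : hgraph C -> Prop) (G : hgraph C) (n : nat)
  (Vs : 'I_n -> {set vert G}) : Prop :=
  [/\ is_partition Vs,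
      forall i, Vs i != set0
    & forall k, 0 < k -> join_sub (fun i => copies k (induced (Vs i))) P].

(* [dec_graph P G m] means dec_P(G) = m. *)
Definition dec_graph (P : hgraph C -> Prop) (G : hgraph C) (m : nat) : Prop :=
  (P G -> (exists Vs : 'I_m -> {set vert G}, decomposition P Vs) /\
          (forall n (Vs : 'I_n -> {set vert G}), decomposition P Vs -> n <= m))
  /\ (~ P G -> m = 0).

Definition strict (P : hgraph C -> Prop) (G : hgraph C) : Prop :=
  P G /\ ~ join_sub (fun b : bool => if b then G else K1) P.

(* [dec P n] means dec(P) = n. *)
Definition dec (P : hgraph C -> Prop) (n : nat) : Prop :=
  (exists G, strict P G /\ dec_graph P G n) /\
  (forall G m, strict P G -> dec_graph P G m -> n <= m).

Definition irr_factorisation (P : hgraph C -> Prop) (n : nat)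
  (Ps : 'I_n -> hgraph C -> Prop) : Prop :=
  (forall i, irreducible (Ps i)) /\ same_class P (compose Ps).

End Constructions.

(* Main.v *)
Require Import Defs.
From HB Require Import structures.
From mathcomp Require Import all_boot.
From mathcomp Require boolp classical_sets filter.

(** Two ideas carry the proof.

    Limits.  Fix an ultrafilter on a directed family of vertex-coloured
    hypergraphs [G_t] and let [R_k] be the class of [F] that embed, for almost
    all [t], in a disjoint union of copies of the [k]-coloured part of [G_t].
    Each [R_k] is additive and induced-hereditary.  A hypergraph embedding in
    almost all [G_t] inherits a colouring from almost all of them, and finitely
    many hypergraphs are dealt with by a single [t]; so if the colourings are
    P-decompositions and the [G_t] are cofinal in P, then P is the composition
    of the [R_k].  Every P-strict hypergraph has a P-decomposition with dec(P)
    parts, so this produces dec(P) factors, and no factorisation has more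
    because a strict hypergraph meets every factor.

    Refinement.  If A_1 o ... o A_n is contained in B_1 o ... o B_m, there are
    [R_ij] with A_i contained in the composition of the i-th row and the
    composition of the j-th column contained in B_j.  By the limit argument it
    is enough to colour, for each coloured [G], its vertices with [m] colours so
    that all blowups of the j-th colour class are in B_j.  If each of the
    finitely many colourings W had a bad blowup, one could paste the edges of
    the bad blowups between copies of [G] to get a member of A_1 o ... o A_n
    which has no (B_1, ..., B_m)-partition.

    With n = dec(P) factors A_i, counting the nontrivial [R_ij] in refinements
    against another factorisation Q_j, in both directions, shows that each Q_j is
    the composition of the A_i in a fibre of a map from the indices i to the
    indices j; irreducibility makes this map bijective. *)

Set Implicit Arguments.
Unset Strict Implicit.
Unset Printing Implicit Defensive.

(** * Finiteness of edge sets, and ultrafilters *)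

Lemma uniq_edge_fin (C : eqType) (V : finType) (E : seq V -> C -> Prop)
    (cs : seq C) :
    (forall s c, E s c -> uniq s /\ c \in cs) ->
  exists l : seq (seq V * C), forall s c, E s c -> (s, c) \in l.
Proof.
move=> HE.
exists (flatten [seq [seq (tval t, c) | t <- enum {: k.-tuple V}, c <- cs]
                | k <- iota 0 #|V|.+1]) => s c /HE [us cc].
apply/flatten_mapP; exists (size s).
  by rewrite mem_iota /= add0n ltnS -(card_uniqP us) max_card.
apply/allpairsP; exists (in_tuple s, c).
by rewrite mem_enum /=.
Qed.

Lemma edge_colours (C : eqType) (V : finType) (H : hgraph_on C V) :
  exists cs : seq C, forall s c, edge H s c -> c \in cs.
Proof.
have [l Hl] := edge_fin H.
by exists (map snd l) => s c /Hl; apply: (map_f snd).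
Qed.

(** The sets containing some [le d] form a proper filter; any ultrafilter above it will do. *)
Lemma exists_ultrafilter (D T : Type) (le : D -> T -> Prop) (d0 : D) :
    (forall d1 d2, exists d, forall t, le d t -> le d1 t /\ le d2 t) ->
    (forall d, exists t, le d t) ->
  exists U : (T -> Prop) -> Prop,
  [/\ forall d, U (le d),
      forall S S', (forall t, S t -> S' t) -> U S -> U S',
      forall S S', U S -> U S' -> U (fun t => S t /\ S' t),
      forall S, U S -> exists t, S t
    & forall S, U S \/ U (fun t => ~ S t)].
Proof.
move=> dir ex.
pose F : classical_sets.set_system T := fun S => exists d, forall t, le d t -> S t.
have FF : filter.ProperFilter F.
  constructor; first by case=> d Hd; have [t /Hd] := ex d.
  constructor; first by exists d0.
    move=> A B [d1 H1] [d2 H2]; have [d Hd] := dir d1 d2.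
    by exists d => t /Hd[/H1 a /H2 b]; split.
  by move=> A B AB [d Hd]; exists d => t /Hd /AB.
have [U [UU FU]] := filter.ultraFilterLemma FF.
exists U; split.
- by move=> d; apply: FU; exists d.
- by move=> S S'; apply: filter.filterS.
- by move=> S S'; apply: filter.filterI.
- move=> S US; apply: boolp.contrapT => nS.
  apply: (@filter.filter_not_empty T U); apply: filter.filterS US => t St.
  by apply: nS; exists t.
- by move=> S; apply: filter.in_ultra_setVsetC.
Qed.

Lemma ultra_fin (T : Type) (K : finType) (U : (T -> Prop) -> Prop) :
    (forall S S' : T -> Prop, (forall t, S t -> S' t) -> U S -> U S') ->
    (forall S S', U S -> U S' -> U (fun t => S t /\ S' t)) ->
    U (fun _ => True) ->
  forall S : K -> T -> Prop, (forall k, U (S k)) -> U (fun t => forall k, S k t).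
Proof.
move=> US UI UT S HS.
suff H (r : seq K) : U (fun t => forall k, k \in r -> S k t).
  by apply: US (H (enum K)) => t Ht k; apply: Ht; rewrite mem_enum.
elim: r => [|k r IH]; first by apply: US UT => t _ k.
apply: US (UI _ _ (HS k) IH) => t [Hk Hr] k'.
by rewrite inE => /orP[/eqP->|/Hr].
Qed.

Lemma ultra_pick (T : Type) (K : finType) (U : (T -> Prop) -> Prop) :
    (forall S S' : T -> Prop, (forall t, S t -> S' t) -> U S -> U S') ->
    (forall S S', U S -> U S' -> U (fun t => S t /\ S' t)) ->
    (forall S, U S -> exists t, S t) ->
    (forall S, U S \/ U (fun t => ~ S t)) ->
  forall S : K -> T -> Prop, U (fun t => exists k, S k t) -> exists k, U (S k).
Proof.
move=> US UI UE UC S HS; apply: boolp.contrapT => nS.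
have UT : U (fun _ => True) by apply: US HS.
have /(ultra_fin US UI UT) nSk : forall k, U (fun t => ~ S k t).
  by move=> k; have [Uk|//] := UC (S k); case: nS; exists k.
by have [t [[k Sk] /(_ k)]] := UE _ (UI _ _ HS nSk).
Qed.

(** * Induced embeddings and colourings *)

Section Embeddings.
Variable C : eqType.
Implicit Types (F G H : hgraph C) (P Q : hgraph C -> Prop).

Definition embedding F H (f : vert F -> vert H) : Prop :=
  injective f /\ forall s c, edge F s c <-> edge H (map f s) c.

Definition emb F H : Prop := exists f : vert F -> vert H, embedding f.

Definition ival H (U : {set vert H}) (x : vert (induced U)) : vert H := val x.

Lemma ivalP H (U : {set vert H}) (x : vert (induced U)) : ival x \in U.
Proof. exact: valP x. Qed.

Lemma ival_inj H (U : {set vert H}) : injective (@ival H U).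
Proof. exact: val_inj. Qed.

Lemma ival_embedding H (U : {set vert H}) : embedding (@ival H U).
Proof. by split; [apply: ival_inj|]. Qed.

Lemma ival_surj H (U : {set vert H}) x : x \in U ->
  exists y : vert (induced U), ival y = x.
Proof. by move=> xU; exists (exist _ x xU). Qed.

Lemma embedding_comp F G H (f : vert F -> vert G) (g : vert G -> vert H) :
  embedding f -> embedding g -> embedding (g \o f).
Proof.
move=> [fi fe] [gi ge]; split; first exact: inj_comp.
by move=> s c; rewrite map_comp -ge -fe.
Qed.

Lemma emb_trans F G H : emb F G -> emb G H -> emb F H.
Proof. by move=> [f Hf] [g Hg]; exists (g \o f); apply: embedding_comp. Qed.

Lemma emb_induced H (U : {set vert H}) : emb (induced U) H.
Proof. by exists (@ival H U); apply: ival_embedding. Qed.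

Lemma embedding_lift F H (f : vert F -> vert H) (U : {set vert H}) :
    embedding f -> (forall x, f x \in U) ->
  exists2 g : vert F -> vert (induced U), embedding g & forall x, ival (g x) = f x.
Proof.
move=> [fi fe] fU.
exists (fun x => exist (fun y => y \in U) (f x) (fU x)) => //.
split=> [x y [] /fi //|s c]; rewrite fe /= /induced_edge -map_comp.
exact: iff_refl.
Qed.

Lemma emb_lift F H (f : vert F -> vert H) (U : {set vert H}) :
  embedding f -> (forall x, f x \in U) -> emb F (induced U).
Proof. by move=> fe /(embedding_lift fe)[g ge _]; exists g. Qed.

Lemma emb_ind_sub F H : emb F H -> ind_sub F H.
Proof.
move=> [f fe]; exists (f @: setT).
have [|g [gi ge] gf] := embedding_lift (U := f @: setT) fe.
  by move=> x; apply: imset_f.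
exists g; split=> //; apply: inj_card_bij => //.
rewrite card_sig (eq_card (B := f @: setT)) ?card_imset ?cardsT //.
exact: proj1 fe.
Qed.

Lemma iso_emb F H : iso F H -> emb F H.
Proof. by move=> [f [fb fe]]; exists f; split=> //; apply: bij_inj. Qed.

Lemma ind_sub_emb F H : ind_sub F H -> emb F H.
Proof. by move=> [U /iso_emb] /emb_trans; apply; apply: emb_induced. Qed.

Lemma iso_sym F H : iso F H -> iso H F.
Proof.
move=> [f [[g fK gK] fe]]; exists g; split; first by exists f.
by move=> s c; rewrite fe -map_comp (eq_map gK) map_id.
Qed.

(* Additive induced-hereditary, except that the class of null hypergraphs is
   allowed. *)
Definition adher P : Prop :=
  additive P /\ forall F H, emb F H -> P H -> P F.

Lemma edge_nil (V : finType) (H : hgraph_on C V) c : ~ edge H [::] c.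
Proof. by move/edge_wf=> []. Qed.

Lemma edge_neq (V : finType) (H : hgraph_on C V) s c : edge H s c ->
  exists x y, [/\ x \in s, y \in s & x != y].
Proof.
move/edge_wf=> []; case: s => [|x [|y s]] //= _.
by rewrite inE negb_or => /andP[/andP[xy _] _]; exists x, y; rewrite !inE !eqxx orbT.
Qed.

Lemma emb_empty F H : (vert F -> False) -> emb F H.
Proof.
move=> F0; exists (fun x => False_rect _ (F0 x)); split.
  by move=> x; case: (F0 x).
by case=> [|x s] c; [split=> /edge_nil | case: (F0 x)].
Qed.

Lemma adher_empty P F : adher P -> (vert F -> False) -> P F.
Proof.
move=> [Pa Ph] F0.
apply: Ph (emb_empty (dunion (fun v : void => K0 C)) F0) _.
by apply: Pa => -[].
Qed.

Lemma emb_K1 F : vert F -> emb (K1 C) F.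
Proof.
move=> x; exists (fun _ => x); split; first by move=> [] [].
move=> s c; split=> [[]|/edge_neq[y [z []]]].
by move=> /mapP[_ _ ->] /mapP[_ _ ->]; rewrite eqxx.
Qed.

Lemma emb_to_K1 F : (forall x y : vert F, x = y) -> emb F (K1 C).
Proof.
move=> Fx; exists (fun _ => tt); split=> // s c.
by split=> [/edge_neq[x [y []]]|[]]; rewrite (Fx x y) eqxx.
Qed.

Lemma adher_K1 P F : adher P -> P F -> vert F -> P (K1 C).
Proof. by move=> [_ Ph] PF /emb_K1 /Ph; apply. Qed.

(** Any vertex induces a copy of [K1], so for a hereditary class nontriviality amounts to containing
    [K1]. *)
Lemma add_ind_herE P : add_ind_her P <-> adher P /\ P (K1 C).
Proof.
split=> [[[Pi P0 [H [PH /card_gt0P[x _]]]] Pa Ph]|[PP P1]].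
  have PP : adher P by split=> // F K /emb_ind_sub FK PK; apply: Ph FK.
  by split=> //; apply: adher_K1 PH x.
have [Pa Ph] := PP; split=> //.
  split; last by exists (K1 C); rewrite card_unit.
    by move=> G H /iso_sym /iso_emb /Ph; apply.
  exact: adher_empty.
by move=> H K PH /ind_sub_emb /Ph; apply.
Qed.

Definition part H (I : eqType) (h : vert H -> I) (i : I) : hgraph C :=
  induced [set x | h x == i].

Lemma part_ival H (I : eqType) (h : vert H -> I) i (x : vert (part h i)) :
  h (ival x) = i.
Proof. by have := ivalP x; rewrite inE => /eqP. Qed.

Lemma emb_part F H (I : eqType) (h : vert H -> I) i (f : vert F -> vert H) :
  embedding f -> (forall x, h (f x) = i) -> emb F (part h i).
Proof. by move=> fe fi; apply: (emb_lift fe) => x; rewrite inE fi. Qed.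

Lemma emb_part_comp F H (I : eqType) (h : vert H -> I) i (f : vert F -> vert H) :
  embedding f -> emb (part (h \o f) i) (part h i).
Proof.
move=> fe; apply: (emb_part (f := f \o @ival _ _)).
  exact: embedding_comp (ival_embedding _) fe.
by move=> x; rewrite /= -[RHS](part_ival x).
Qed.

Definition composite (I : finType) (Ps : I -> hgraph C -> Prop) H : Prop :=
  exists h : vert H -> I, forall i, Ps i (part h i).

Lemma composeE (I : finType) (Ps : I -> hgraph C -> Prop) H :
  (forall i, adher (Ps i)) -> compose Ps H <-> composite Ps H.
Proof.
move=> PP; split=> [[Vs [[Vd VT] HV]]|[h Hh]]; last first.
  exists (fun i => [set x | h x == i]); split=> //; split=> [i j ij|].
    rewrite -setI_eq0; apply/eqP/setP=> x; rewrite !inE.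
    by apply/negP=> /andP[/eqP-> /eqP e]; rewrite e eqxx in ij.
  by apply/setP=> x; rewrite !inE; apply/bigcupP; exists (h x); rewrite ?inE.
have /fin_all_exists[h Hh] (x : vert H) : exists i, x \in Vs i.
  have : x \in \bigcup_i Vs i by rewrite VT inE.
  by case/bigcupP=> i _ xi; exists i.
exists h => i; apply: (proj2 (PP i)) (HV i).
apply: (emb_lift (ival_embedding _)) => x.
by rewrite -[X in Vs X](part_ival x).
Qed.

End Embeddings.

(** * Blowups of coloured hypergraphs *)

Section Blowups.
Variable C : eqType.
Implicit Types (F G H : hgraph C) (P Q : hgraph C -> Prop).

Definition const_on (T : eqType) (U : Type) (f : T -> U) (s : seq T) : Prop :=
  forall x y, x \in s -> y \in s -> f x = f y.

Lemma const_on_map (T U : eqType) (V : Type) (g : T -> U) (f : U -> V) s :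
  const_on f (map g s) <-> const_on (f \o g) s.
Proof.
split=> [Hf x y xs ys|Hf _ _ /mapP[x xs ->] /mapP[y ys ->]]; last exact: Hf.
by apply: Hf; apply: map_f.
Qed.

(* [H] consists of copies (numbered by [l]) of subsets of the classes of [h],
   with arbitrary further edges meeting at least two classes: this is the
   embedding form of membership in kG[V_1] * ... * kG[V_n]. *)
Definition blowup G H (I : eqType) (h : vert G -> I) (L : finType)
    (l : vert H -> L) (p : vert H -> vert G) : Prop :=
  injective (fun v => (l v, p v)) /\
  forall s c, const_on (h \o p) s ->
    (edge H s c <-> const_on l s /\ edge G (map p s) c).

(** [F] embeds in a disjoint union of copies of the part of [G] on [D]: the vertex [v] goes to the
    vertex [p v] of copy [l v]. No union has to be built. *)
Definition blow_in F G (D : vert G -> Prop) : Prop :=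
  exists (L : finType) (l : vert F -> L) (p : vert F -> vert G),
  [/\ injective (fun v => (l v, p v)), forall v, D (p v)
    & forall s c, edge F s c <-> const_on l s /\ edge G (map p s) c].

Lemma blow_in_adher P F G (U : {set vert G}) :
  adher P -> P (induced U) -> blow_in F (fun x => x \in U) -> P F.
Proof.
move=> [Pa Ph] PU [L [l [p [lpi pU pe]]]].
have := Pa L (fun _ => induced U) (fun _ => PU); apply: Ph.
pose g v : vert (induced U) := exist (fun y => y \in U) (p v) (pU v).
pose f v : vert (dunion (fun _ : L => induced U)) := existT _ (l v) (g v).
exists f; split.
  move=> v w e; apply: lpi; congr (_, _); first by case: e.
  have /(congr1 (fun z => ival (tagged z))) := e; exact.
move=> s c; rewrite pe; split=> [[ls es]|[i [t [est et]]]].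
  case: s ls es => [_ /edge_nil//|x s] ls es.
  exists (l x), (map g (x :: s)); split.
    apply: etrans (map_comp _ _ _); apply/eq_in_map => y ys /=.
    by rewrite /f (ls y x) // mem_head.
  by change (edge G (map val (map g (x :: s))) c); rewrite -map_comp.
have lE v : v \in s -> l v = i.
  by move=> /(map_f f); rewrite est => /mapP[w _ []].
split; first by move=> x y /lE-> /lE->.
have -> : map p s = map (@ival C _ _) t; last exact: et.
have /(congr1 (map (fun z => ival (tagged z)))) := est.
by rewrite -!map_comp.
Qed.

Lemma blow_in_emb F F' G (D : vert G -> Prop) :
  emb F F' -> blow_in F' D -> blow_in F D.
Proof.
move=> [f [fi fe]] [L [l [p [lpi pD pe]]]].
exists L, (l \o f), (p \o f); split=> [v w /lpi /fi //|v|s c]; first exact: pD.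
by rewrite fe pe const_on_map map_comp.
Qed.

Lemma existT_inj (I : eqType) (T : I -> Type) (i : I) :
  injective (existT T i).
Proof.
move=> x y e.
have K (u : {i : I & T i}) (eu : tag u = i) : u = existT T i y ->
    ecast z (T z) eu (tagged u) = y.
  by move=> eq_u; move: eu; rewrite eq_u /= => eu; rewrite eq_axiomK.
exact: (K (existT T i x) erefl e).
Qed.

Lemma seq_tag (I : finType) (T : I -> finType) (s : seq {i : I & T i}) i :
  (forall x, x \in s -> tag x = i) ->
  exists t : seq (T i), s = map (Tagged (fun j => T j)) t.
Proof.
elim: s => [|[j x] s IH] tagE; first by exists [::].
have [|t ->] := IH; first by move=> y ys; apply: tagE; rewrite inE ys orbT.
have ji : j = i := tagE (existT _ j x) (mem_head _ _).
by move: x {tagE IH}; rewrite ji => x; exists (x :: t).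
Qed.

Lemma blow_in_dunion (I : finType) (Fs : I -> hgraph C) G (D : vert G -> Prop) :
  (forall i, blow_in (Fs i) D) -> blow_in (dunion Fs) D.
Proof.
move=> /fin_all_exists[L] /fin_all_exists[l] /fin_all_exists[p Hlp].
exists {i : I & L i},
  (fun v => existT (fun i => Finite.sort (L i)) (tag v) (l (tag v) (tagged v))),
  (fun v => p (tag v) (tagged v)); split.
- move=> [i v] [j w] /= [ij]; move: ij v w; case: _ / => v w e2 e3.
  have {}e2 := existT_inj e2.
  by have [lpi _ _] := Hlp i; congr (existT _ _ _); apply: lpi; rewrite e2 e3.
- by move=> [i v]; have [] := Hlp i.
move=> s c; split=> [[i [t [-> et]]]|[ls es]].
  have [_ _ pe] := Hlp i; have [lt ept] := (pe t c).1 et; split.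
    by rewrite const_on_map => x y xt yt /=; rewrite (lt x y).
  by rewrite -map_comp.
case: s ls es => [_ /edge_nil//|[i v] s] ls es.
have tagE x : x \in existT _ i v :: s -> tag x = i.
  by move=> xs; have := ls x _ xs (mem_head _ _) => -[].
have [t est] := seq_tag tagE.
exists i, t; split=> //; have [_ _ pe] := Hlp i; apply/pe.
move: ls es; rewrite est const_on_map -map_comp => ls es; split=> // x y xt yt.
exact: existT_inj (ls x y xt yt).
Qed.

Lemma blowup_part G H (I : eqType) (h : vert G -> I) (L : finType)
    (l : vert H -> L) (p : vert H -> vert G) i :
  blowup h l p -> blow_in (part (h \o p) i) (fun x => x \in [set y | h y == i]).
Proof.
move=> [lpi pe]; exists L, (l \o @ival C _ _), (p \o @ival C _ _); split.
- by move=> v w /lpi /ival_inj.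
- by move=> v; rewrite inE; apply/eqP; apply: (part_ival v).
move=> s c.
have hs : const_on (h \o p) (map (@ival C _ _) s).
  by rewrite const_on_map => x y _ _; exact: etrans (part_ival x) (esym (part_ival y)).
have := pe _ c hs; rewrite const_on_map -map_comp; apply: iff_trans.
exact: iff_refl.
Qed.

Lemma blowup_comp G H (I : finType) (h : vert G -> I) (L : finType)
    (l : vert H -> L) (p : vert H -> vert G) (A : I -> hgraph C -> Prop) :
  (forall i, adher (A i)) -> (forall i, A i (part h i)) -> blowup h l p ->
  forall i, A i (part (h \o p) i).
Proof.
move=> hA Ah hb i; exact: blow_in_adher (hA i) (Ah i) (blowup_part i hb).
Qed.

(** A finer colouring has fewer monochromatic tuples, so it imposes fewer conditions on edges. *)
Lemma blowup_finer G H (I J : eqType) (h : vert G -> I) (h' : vert G -> J)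
    (L : finType) (l : vert H -> L) (p : vert H -> vert G) :
  (forall x y, h x = h y -> h' x = h' y) -> blowup h' l p -> blowup h l p.
Proof.
move=> hh' [lpi pe]; split=> // s c hs; apply: pe => x y xs ys /=.
by apply: hh'; apply: hs.
Qed.

End Blowups.

(** * Pasting bad blowups together *)

Section Refinement.
Variable C : eqType.
Implicit Types (F G H : hgraph C) (P Q : hgraph C -> Prop).

Lemma composite_emb (I : finType) (Ps : I -> hgraph C -> Prop) F H :
  (forall i, adher (Ps i)) -> emb F H -> composite Ps H -> composite Ps F.
Proof.
move=> PP [f fe] [h Hh]; exists (h \o f) => i.
exact: (proj2 (PP i)) (emb_part_comp h i fe) (Hh i).
Qed.

Section Amalgam.
Variables (G H G' : hgraph C) (I L L' : finType) (h : vert G -> I).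
Variables (l : vert H -> L) (p : vert H -> vert G).
Variables (l' : vert G' -> L') (p' : vert G' -> vert G).
Hypotheses (Hb : blowup h l p) (Gb : blowup h l' p').

Definition amalgam_vert : finType := ((L * I) * vert G')%type.

(** [slot v] names the block meant for [v] and the vertex of [G] below [v]; a vertex [z] of the
    amalgam can stand for [v] when [key z] equals [slot v]. *)
Let key (z : amalgam_vert) : (L * I) * vert G := (z.1, p' z.2).
Let slot (v : vert H) : (L * I) * vert G := ((l v, h (p v)), p v).

Lemma slot_inj : injective slot.
Proof. by move=> v w [lvw _ pvw]; apply: (proj1 Hb); rewrite /= lvw pvw. Qed.

(* One copy of [G'] for each pair (copy of [G] in [H], class of [h]); the edges
   of [H] that meet several classes are put between these copies, over all
   choices of preimages under [p']. *)
Definition amalgam_edge (s : seq amalgam_vert) (c : C) : Prop :=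
  (exists b t, s = map (pair b) t /\ edge G' t c) \/
  (exists t, [/\ map key s = map slot t, edge H t c & ~ const_on (h \o p) t]).

Lemma amalgam_wf s c : amalgam_edge s c -> 2 <= size s /\ uniq s.
Proof.
case=> [[b [t [-> /edge_wf[t2 ut]]]]|[t [st /edge_wf[t2 ut] _]]].
  by rewrite size_map map_inj_uniq // => x y [].
rewrite -(size_map key) st size_map; split=> //.
by apply: (@map_uniq _ _ key); rewrite st map_inj_uniq //; apply: slot_inj.
Qed.

Lemma amalgam_fin : exists E : seq (seq amalgam_vert * C),
  forall s c, amalgam_edge s c -> (s, c) \in E.
Proof.
have [cs Hcs] := edge_colours H; have [cs' Hcs'] := edge_colours G'.
apply: (@uniq_edge_fin _ _ _ (cs ++ cs')) => s c e.
have [_ ->] := amalgam_wf e; split=> //; rewrite mem_cat.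
by case: e => [[b [t [_ /Hcs' ->]]]|[t [_ /Hcs -> _]]]; rewrite ?orbT.
Qed.

Definition amalgam : hgraph C := HGraph (HGraphOn amalgam_wf amalgam_fin).

Definition amalgam_copy (z : vert amalgam) : (L * I) * L' := (z.1, l' z.2).
Definition amalgam_proj (z : vert amalgam) : vert G := p' z.2.

(** Vertices of a pasted edge that share a block share their class under [h], but a pasted edge
    meets two classes; so none lies inside a block. *)
Lemma amalgam_block b : @embedding C G' amalgam (pair b).
Proof.
split=> [x y []//|s c]; split=> [e|]; first by left; exists b, s.
case=> [[b' [t [st et]]]|[t [st et []]]].
  suff -> : s = t by [].
  by have /(congr1 (map snd)) := st; rewrite -!map_comp !map_id.
have tb v : v \in t -> (l v, h (p v)) = b.
  move=> /(map_f slot); rewrite -st -map_comp => /mapP[x _].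
  by case.
by move=> v w /tb ev /tb ew; have [] := etrans ev (esym ew).
Qed.

(** Pasted edges meet several classes of [h] and escape the blowup condition, which inside a block
    comes from [G']. Hence the construction can be iterated. *)
Lemma amalgam_blowup : blowup h amalgam_copy amalgam_proj.
Proof.
have [lpi pe] := Gb; split.
  move=> [b x] [b' x'] [-> lx px]; congr pair; apply: lpi.
  by congr pair.
move=> s c hs; split.
  case=> [[b [t [est et]]]|[t [st et []]]].
    move: hs; rewrite est const_on_map => hs.
    have [lt ept] := (pe t c hs).1 et; rewrite const_on_map -map_comp.
    by split=> // x y xt yt; rewrite /amalgam_copy /= (lt x y).
  have aux v : v \in t -> exists2 z, z \in s & h (amalgam_proj z) = h (p v).
    move=> /(map_f slot); rewrite -st => /mapP[z zs [_ e]].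
    by exists z => //; rewrite e.
  move=> v w /aux[z zs ez] /aux[z' zs' ez'].
  exact: etrans (esym ez) (etrans (hs _ _ zs zs') ez').
case: s hs => [_ [_ /edge_nil//]|[b x] s] hs [ls es].
have bE z : z \in (b, x) :: s -> z.1 = b.
  by move=> /ls /(_ (mem_head _ _)) [->].
have est : (b, x) :: s = map (pair b) (map snd ((b, x) :: s)).
  rewrite -map_comp -[LHS]map_id; apply/eq_in_map => -[b' y] /bE /= -> //.
left; exists b, (map snd ((b, x) :: s)); split=> //.
apply/pe.
  by rewrite const_on_map.
rewrite -map_comp; split=> //; rewrite const_on_map => z z' zs zs'.
by have [] := ls z z' zs zs'.
Qed.

(** Whatever copy of [G] is chosen in each block, these copies together carry a copy of [H], because
    edges were pasted over all preimages. *)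
Lemma amalgam_section (sec : L * I -> vert G -> vert G') :
    (forall b x, p' (sec b x) = x) ->
    (forall b x y, l' (sec b x) = l' (sec b y)) ->
  @embedding C H amalgam (fun v => ((l v, h (p v)), sec (l v, h (p v)) (p v))).
Proof.
move=> secK secl; have [lpi pe] := Hb.
set f := fun v => _.
have keyf v : key (f v) = slot v by rewrite /key /f /= secK.
split=> [v w e|s c]; first by apply: slot_inj; rewrite -!keyf e.
have [hs|nhs] := boolp.EM (const_on (h \o p) s); last first.
  split=> [es|]; first by right; exists s; rewrite -map_comp; split=> //; apply: eq_map.
  case=> [[b [t [st et]]]|[t [st et _]]].
    case: nhs => v w vs ws.
    have bE u : u \in s -> (l u, h (p u)) = b.
      by move=> /(map_f f); rewrite st => /mapP[z _ []].
    by have [] := etrans (bE _ vs) (esym (bE _ ws)).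
  suff -> : s = t by [].
  apply: (inj_map slot_inj); rewrite -st -map_comp; apply: eq_map => v.
  by rewrite /= keyf.
have pf v : amalgam_proj (f v) = p v by rewrite /amalgam_proj /= secK.
have hfs : const_on (h \o amalgam_proj) (map f s).
  by rewrite const_on_map => v w vs ws; rewrite /= !pf; apply: hs.
have := (proj2 amalgam_blowup) _ c hfs; rewrite pe // const_on_map -map_comp.
rewrite (eq_map pf) => ->.
suff -> : const_on (amalgam_copy \o f) s <-> const_on l s by [].
split=> ls v w vs ws; first by have [] := ls v w vs ws.
have /= hvw := hs v w vs ws; have lvw := ls v w vs ws.
by rewrite /amalgam_copy /= hvw lvw (secl _ (p v) (p w)).
Qed.

End Amalgam.

(** If every [W] had a bad blowup, amalgamating with these one after another would give a blowup of
    [G], hence a member of [composite A], in which every colouring with classes in the [B j] differs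
    from all [W] on some copy of [G]. This is absurd. *)
Lemma refine_colouring (I J : finType) (A : I -> hgraph C -> Prop)
    (B : J -> hgraph C -> Prop) G (h : vert G -> I) :
    (forall i, adher (A i)) -> (forall j, adher (B j)) ->
    (forall H, composite A H -> composite B H) -> (forall i, A i (part h i)) ->
  exists W : vert G -> J,
    forall j H (L : finType) (l : vert H -> L) (p : vert H -> vert G),
      blowup h l p -> (forall v, W (p v) = j) -> B j H.
Proof.
move=> AA BB AB Ah; apply: boolp.contrapT => nW.
(* [Ws] lists the colourings excluded so far; [X] is read along a section of [p'] lying in one copy
   of [G]. *)
suff key (Ws : seq {ffun vert G -> J}) :
    exists G' (L' : finType) (l' : vert G' -> L') (p' : vert G' -> vert G),
    blowup h l' p' /\ forall X : vert G' -> J, (forall j, B j (part X j)) ->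
      exists sec : vert G -> vert G',
      [/\ forall x, p' (sec x) = x, forall x y, l' (sec x) = l' (sec y)
        & finfun (X \o sec) \notin Ws].
  have [G' [L' [l' [p' [Gb GX]]]]] := key (enum {: {ffun vert G -> J}}).
  have [|X /GX[sec []]] := AB G'; last by rewrite mem_enum.
  by exists (h \o p') => i; apply: (blowup_comp AA Ah Gb).
elim: Ws => [|W Ws [G' [L' [l' [p' [Gb GX]]]]]].
  exists G, unit, (fun _ => tt), id; split; last by move=> X _; exists id.
  by split=> [x y []//|s c _]; rewrite map_id; split=> [|[]].
have [j [H [L [l [p [Hb [Wp nB]]]]]]] : exists j H (L : finType)
    (l : vert H -> L) (p : vert H -> vert G),
    blowup h l p /\ (forall v, W (p v) = j) /\ ~ B j H.
  apply: boolp.contrapT => nbad; apply: nW; exists W => j H L l p Hb Wp.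
  by apply: boolp.contrapT => nB; apply: nbad; exists j, H, L, l, p.
have ab := amalgam_blowup Hb Gb.
eexists; eexists; eexists; eexists; split; first exact: ab.
move=> X BX.
have /fin_all_exists[sec Hsec] (b : L * I) : exists sec : vert G -> vert G',
    [/\ forall x, p' (sec x) = x, forall x y, l' (sec x) = l' (sec y)
      & finfun (fun x => X (b, sec x)) \notin Ws].
  apply: (GX (fun u => X (b, u))) => k.
  apply: (proj2 (BB k)) (BX k).
  exact: (emb_part_comp X k (amalgam_block p' Hb b)).
(* If some block shows a pattern other than [W], its copy of [G] serves. Otherwise all blocks show
   [W], and the copy of [H] they carry has constant colour [j] under [X], which forces [B j H]. *)
have [[b bW]|nb] := boolp.EM (exists b, finfun (fun x => X (b, sec b x)) != W).
  have [secK secl nWs] := Hsec b; exists (fun x => (b, sec b x)); split=> //.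
    by move=> x y; rewrite /amalgam_copy /= (secl x y).
  by rewrite inE negb_or bW.
case: nB; apply: (proj2 (BB j)) (BX j).
have e := amalgam_section Hb Gb (sec := sec).
apply: (emb_part (e _ _)) => [b x|b x y|v].
- by have [] := Hsec b.
- by have [] := Hsec b.
rewrite -(Wp v).
have /eqP <- : finfun (fun x => X ((l v, h (p v)), sec (l v, h (p v)) x)) == W.
  by apply/negPn/negP => nb'; apply: nb; exists (l v, h (p v)).
by rewrite ffunE.
Qed.

End Refinement.

(** * Disjoint unions and iterated composition *)

Section Composites.
Variable C : eqType.
Implicit Types (F G H : hgraph C) (P Q : hgraph C -> Prop).

Lemma seq_ival H (U : {set vert H}) (s : seq (vert H)) :
  (forall x, x \in s -> x \in U) ->
  exists t : seq (vert (induced U)), s = map (@ival C H U) t.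
Proof.
elim: s => [|x s IH] sU; first by exists [::].
have [|t ->] := IH; first by move=> y ys; apply: sU; rewrite inE ys orbT.
have [|y <-] := ival_surj (U := U) (x := x); first by apply: sU; apply: mem_head.
by exists (y :: t).
Qed.

Lemma glue H (I : eqType) (c : vert H -> I) (X : Type)
    (f : forall i, vert (part c i) -> X) :
  exists g : vert H -> X, forall i (y : vert (part c i)), g (ival y) = f i y.
Proof.
have cP v : v \in [set x | c x == c v] by rewrite inE.
exists (fun v => f (c v) (exist _ v (cP v))) => i [v vi].
have e : c v = i by move: vi; rewrite inE => /eqP.
case: _ / e vi => vi; rewrite /ival /=.
by congr (f _ (exist _ _ _)); apply: bool_irrelevance.
Qed.

Lemma emb_of_surj F H (U : {set vert H}) (g : vert F -> vert H) :
  embedding g -> (forall x, x \in U -> exists y, g y = x) -> emb (induced U) F.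
Proof.
move=> [gi ge] gU.
have /fin_all_exists[f gf] (y : vert (induced U)) : exists x, g x = ival y.
  by apply: gU; apply: ivalP.
exists f; split=> [x y e|s c]; first by apply: ival_inj; rewrite -!gf e.
rewrite ge -map_comp (eq_map gf); exact: iff_refl.
Qed.

Lemma dunion_embedding (I : finType) (Gs : I -> hgraph C) i :
  @embedding C (Gs i) (dunion Gs) (Tagged (fun j => vert (Gs j))).
Proof.
split=> [x y e|s c]; first exact: existT_inj e.
split=> [e|[j [t [st et]]]].
  by exists i, s.
case: s st => [|x s] st.
  by case: t st et => [|? ?] // _ /edge_nil.
have ji : j = i by case: t st {et} => [|y t] //= [].
move: t st et; rewrite ji => t /inj_map -> // y z; exact: existT_inj.
Qed.

Lemma dunion_map (I : finType) (Gs Hs : I -> hgraph C)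
    (e : forall i, vert (Gs i) -> vert (Hs i)) :
  (forall i, embedding (e i)) ->
  @embedding C (dunion Gs) (dunion Hs)
    (fun z => existT (fun j => Finite.sort (vert (Hs j))) (tag z)
                (e (tag z) (tagged z))).
Proof.
move=> He; split.
  move=> [i x] [j y] /= e1; have ij : i = j by case: e1.
  by move: y e1; rewrite -ij => y e1; have /(proj1 (He i)) -> := existT_inj e1.
move=> s c; split=> [[i [t [-> et]]]|[i [t [st et]]]].
  by exists i, (map (e i) t); split; [rewrite -!map_comp|apply/(proj2 (He i))].
have tagE x : x \in s -> tag x = i.
  move=> xs; have : tag x \in map (fun z => tag z) s by apply: map_f.
  have -> : map (fun z => tag z) s = nseq (size t) i.
    have /(congr1 (map (fun z => tag z))) := st.
    rewrite -!map_comp => ->; elim: (t) => //= ? ? ->//.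
  by rewrite mem_nseq => /andP[_ /eqP].
have [t' est] := seq_tag tagE.
exists i, t'; split=> //; apply/(proj2 (He i)).
have -> // : map (e i) t' = t.
apply: (inj_map (@existT_inj _ (fun j => Finite.sort (vert (Hs j))) i)).
by rewrite -[RHS]st est -!map_comp.
Qed.

Definition dunion_fun (I : finType) (Gs : I -> hgraph C) (X : Type)
    (h : forall i, vert (Gs i) -> X) (z : vert (dunion Gs)) : X :=
  h (tag z) (tagged z).

Lemma dunion_part (I : finType) (Gs : I -> hgraph C) (K : eqType)
    (h : forall i, vert (Gs i) -> K) k :
  emb (part (dunion_fun h) k) (dunion (fun i => part (h i) k)).
Proof.
apply: (emb_of_surj (dunion_map (fun i => ival_embedding [set x | h i x == k]))).
move=> [i x]; rewrite inE /dunion_fun /= => /eqP hx.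
have [|y <-] := ival_surj (U := [set x | h i x == k]) (x := x); first by rewrite inE hx.
by exists (Tagged (fun j => vert (part (h j) k)) y).
Qed.

Lemma adher_dunion_part (I : finType) (Gs : I -> hgraph C) (K : eqType)
    (h : forall i, vert (Gs i) -> K) P k : adher P ->
  (forall i, P (part (h i) k)) -> P (part (dunion_fun h) k).
Proof. by move=> [Pa Ph] /Pa; apply/Ph/dunion_part. Qed.

Lemma composite_adher (I : finType) (Ps : I -> hgraph C -> Prop) :
  (forall i, adher (Ps i)) -> adher (composite Ps).
Proof.
move=> PP; split=> [K Gs|F H FH]; last exact: composite_emb.
move=> /fin_all_exists[h Hh]; exists (dunion_fun h) => i.
exact: adher_dunion_part.
Qed.

(** A unit for composition; it pads families of classes to a fixed index type. *)
Definition null_class H : Prop := vert H -> False.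

Lemma null_class_adher : adher null_class.
Proof. by split=> [I Gs G0 [i /G0]|F H [f _] H0 /f]. Qed.

Lemma part_inhab H (I : eqType) (c : vert H -> I) (v : vert H) : vert (part c (c v)).
Proof. by exists v; rewrite inE. Qed.

Lemma composite_mono (I : finType) (A B : I -> hgraph C -> Prop) H :
  (forall i F, A i F -> B i F) -> composite A H -> composite B H.
Proof. by move=> AB [h Hh]; exists h => i; apply: AB. Qed.

Lemma composite_flatten (I J : finType) (A : I -> hgraph C -> Prop)
    (Z : I -> J -> hgraph C -> Prop) H :
    (forall i j, adher (Z i j)) -> (forall i F, A i F -> composite (Z i) F) ->
  composite A H -> composite (fun ij => Z ij.1 ij.2) H.
Proof.
move=> ZZ AZ [h Hh].
have /fin_all_exists[hs Hhs] i := AZ i _ (Hh i).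
have [g Hg] := glue (fun i y => (i, hs i y)).
exists g => -[i j] /=; apply: (proj2 (ZZ i j)) (Hhs i j).
have [|e ee ev] := embedding_lift (U := [set x | h x == i])
    (ival_embedding [set x | g x == (i, j)]).
  move=> y; have := part_ival y.
  have [z <-] : exists z : vert (part h (h (ival y))), ival z = ival y.
    by apply: ival_surj; rewrite inE.
  by rewrite Hg inE (part_ival z) => /(congr1 fst) /= ->.
apply: (emb_part ee) => x.
by have := part_ival x; rewrite -ev Hg => -[].
Qed.

Lemma composite_group (K J : finType) (Z : K -> hgraph C -> Prop)
    (B : J -> hgraph C -> Prop) (f : K -> J) H :
    (forall k, adher (Z k)) ->
    (forall j F (c : vert F -> K), (forall v, f (c v) = j) ->
       (forall k, Z k (part c k)) -> B j F) ->
  composite Z H -> composite B H.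
Proof.
move=> ZZ ZB [h Hh]; exists (f \o h) => j.
apply: (ZB _ _ (h \o @ival C _ _)) => [v|k]; first exact: (part_ival v).
exact: (proj2 (ZZ k)) (emb_part_comp h k (ival_embedding _)) (Hh k).
Qed.

Lemma composite_group1 (I J : finType) (A : I -> hgraph C -> Prop)
    (Z : I -> J -> hgraph C -> Prop) H :
    (forall i j, adher (Z i j)) -> (forall i F, composite (Z i) F -> A i F) ->
  composite (fun ij => Z ij.1 ij.2) H -> composite A H.
Proof.
move=> ZZ ZA; apply: (composite_group (f := fst)) => // i F c ci Hc.
apply: ZA; exists (snd \o c) => j; apply: (proj2 (ZZ i j)) (Hc (i, j)).
apply: (emb_part (ival_embedding _)) => x.
by rewrite [LHS]surjective_pairing ci -[in RHS](part_ival x).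
Qed.

Lemma composite_group2 (I J : finType) (B : J -> hgraph C -> Prop)
    (Z : I -> J -> hgraph C -> Prop) H :
    (forall i j, adher (Z i j)) ->
    (forall j F, composite (fun i => Z i j) F -> B j F) ->
  composite (fun ij => Z ij.1 ij.2) H -> composite B H.
Proof.
move=> ZZ ZB; apply: (composite_group (f := snd)) => // j F c cj Hc.
apply: ZB; exists (fst \o c) => i; apply: (proj2 (ZZ i j)) (Hc (i, j)).
apply: (emb_part (ival_embedding _)) => x.
by rewrite [LHS]surjective_pairing cj -[in RHS](part_ival x).
Qed.

Lemma emb_part_all F (I : eqType) (c : vert F -> I) i :
  (forall v, c v = i) -> emb F (part c i).
Proof. by apply: (emb_part (f := id)); split=> // s cc; rewrite map_id. Qed.

Lemma colour_K1 (I : eqType) (Z : I -> hgraph C -> Prop) F (c : vert F -> I) v :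
  (forall i, adher (Z i)) -> (forall i, Z i (part c i)) -> Z (c v) (K1 C).
Proof. by move=> ZZ Hc; apply: adher_K1 (Hc (c v)) (part_inhab c v). Qed.

(** A colour that occurs puts [K1] in its class, so only the colour [i] can occur. *)
Lemma composite_single (I : finType) (Z : I -> hgraph C -> Prop) i F :
    (forall i, adher (Z i)) -> (forall i', Z i' (K1 C) -> i' = i) ->
  composite Z F -> Z i F.
Proof.
move=> ZZ Zi [c Hc]; apply: (proj2 (ZZ i)) (Hc i).
by apply: emb_part_all => v; apply: Zi; apply: (colour_K1 v ZZ Hc).
Qed.

Lemma composite_incl (I : finType) (Z : I -> hgraph C -> Prop) i F :
  (forall i, adher (Z i)) -> Z i F -> composite Z F.
Proof.
move=> ZZ ZF; exists (fun _ => i) => i'.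
have [<-|ne] := eqVneq i i'; first exact: (proj2 (ZZ i)) (emb_induced _) ZF.
by apply: adher_empty => // x; rewrite -[i'](part_ival x) eqxx in ne.
Qed.

End Composites.

(** * Limit classes of an ultrafilter *)

Section Limits.
Variables (C : eqType) (T : Type) (Gt : T -> hgraph C) (K : finType).
Variable w : forall t, vert (Gt t) -> K.
Variable U : (T -> Prop) -> Prop.
Hypothesis US : forall S S' : T -> Prop, (forall t, S t -> S' t) -> U S -> U S'.
Hypothesis UI : forall S S', U S -> U S' -> U (fun t => S t /\ S' t).
Hypothesis UE : forall S, U S -> exists t, S t.
Hypothesis UC : forall S, U S \/ U (fun t => ~ S t).

Definition limit_class (k : K) (F : hgraph C) : Prop :=
  U (fun t => @blow_in C F (Gt t) (fun x => w x = k)).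

Lemma ultra_true : U (fun _ => True).
Proof. by have [/US|/US] := UC (fun _ => True); apply. Qed.

Lemma limit_adher k : adher (limit_class k).
Proof.
split=> [I Gs /(ultra_fin US UI ultra_true)|F H FH]; apply: US => t.
  exact: blow_in_dunion.
exact: blow_in_emb.
Qed.

(** Copies are tagged by their class; a blowup leaves edges across classes unconstrained, so the
    pieces fit together. *)
Lemma blow_in_glue (G H : hgraph C) (v : vert G -> K) (c : vert H -> K) :
    (forall k, blow_in (part c k) (fun x => v x = k)) ->
  exists (L : finType) (l : vert H -> L) (p : vert H -> vert G),
    blowup v l p /\ forall x, v (p x) = c x.
Proof.
move=> /fin_all_exists[L] /fin_all_exists[l] /fin_all_exists[p Hlp].
have [l' Hl] := glue (fun k y => existT (fun k => Finite.sort (L k)) k (l k y)).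
have [p' Hp] := glue p.
have vp x : v (p' x) = c x.
  have [|y <-] := ival_surj (U := [set y | c y == c x]) (x := x); first by rewrite inE.
  by rewrite Hp; have [_ -> _] := Hlp (c x); rewrite -[LHS](part_ival y).
exists {k : K & L k}, l', p'; split=> //; split.
  move=> x x' [] e1 e2; have e3 : c x = c x' by rewrite -!vp e2.
  have [|y ey] := ival_surj (U := [set y | c y == c x]) (x := x); first by rewrite inE.
  have [|y' ey'] := ival_surj (U := [set y | c y == c x]) (x := x').
    by rewrite inE e3.
  move: e1 e2; rewrite -ey -ey' !Hl !Hp => e1 e2; have {}e1 := existT_inj e1.
  congr ival.
  by have [inj _ _] := Hlp (c x); apply: inj; rewrite e1 e2.
move=> [|x s] cc cs; first by split=> [/edge_nil|[_ /edge_nil]].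
have [|t ->] := seq_ival (U := [set y | c y == c x]) (s := x :: s).
  by move=> y ys; rewrite inE -!vp; apply/eqP/cs => //; apply: mem_head.
have [_ _ pe] := Hlp (c x); have := pe t cc.
rewrite const_on_map -map_comp (eq_map (Hp (c x))) => e; apply: iff_trans e _.
suff -> : const_on (l' \o ival (U:=[set y | c y == c x])) t <->
          const_on (l (c x)) t by [].
split=> H1 y z yt zt; last by rewrite /= !Hl (H1 y z).
have := H1 y z yt zt; rewrite /= !Hl => e1; exact: existT_inj e1.
Qed.

Lemma limit_blowup (H : hgraph C) (c : vert H -> K) :
    (forall k, limit_class k (part c k)) ->
  exists t (L : finType) (l : vert H -> L) (p : vert H -> vert (Gt t)),
    blowup (@w t) l p /\ forall x, w (p x) = c x.
Proof.
move=> /(ultra_fin US UI ultra_true) /UE [t /blow_in_glue Ht].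
by exists t.
Qed.

(** Embeddings pull [w] back to [F], which has finitely many colourings, so one of them arises for
    almost all [t]. *)
Lemma limit_split (F : hgraph C) (D : K -> Prop) :
    U (fun t => exists e : vert F -> vert (Gt t),
                  embedding e /\ forall v, D (w (e v))) ->
  exists c : vert F -> K, (forall v, D (c v)) /\
    forall k, limit_class k (part c k).
Proof.
move=> UF.
have [|c Uc] := ultra_pick (K := {ffun vert F -> K}) US UI UE UC (S := fun c t =>
    exists e : vert F -> vert (Gt t),
      embedding e /\ (forall v, D (w (e v)) /\ w (e v) = c v)).
  apply: US UF => t [e [ee De]]; exists (finfun (@w t \o e)), e.
  by split=> // v; rewrite ffunE.
exists c; split=> [v|k].
  by have [t [e [_ De]]] := UE Uc; have [Dv <-] := De v.
apply: US Uc => t [e [ee ec]].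
exists unit, (fun _ => tt), (e \o @ival C _ _).
have [fi fe] := embedding_comp (ival_embedding [set x | c x == k]) ee; split.
- by move=> x y [] /fi.
- by move=> x /=; have [_ ->] := ec (ival x); rewrite -[RHS](part_ival x).
by move=> s cc; have := fe s cc => e1; split=> [/e1|[_ /e1]].
Qed.

End Limits.

(** * Common refinements *)

Section CommonRefinement.
Variable C : eqType.
Implicit Types (F G H : hgraph C) (P Q : hgraph C -> Prop).

Definition refines (I J : finType) (A : I -> hgraph C -> Prop)
    (B : J -> hgraph C -> Prop) (R : I -> J -> hgraph C -> Prop) : Prop :=
  [/\ forall i j, adher (R i j),
      forall i F, A i F -> composite (R i) F
    & forall j F, composite (fun i => R i j) F -> B j F].

Lemma dunion2 G1 G2 : exists G (e1 : vert G1 -> vert G) (e2 : vert G2 -> vert G),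
  [/\ embedding e1, embedding e2,
      forall P, adher P -> P G1 -> P G2 -> P G
    & forall (I : eqType) (h1 : vert G1 -> I) (h2 : vert G2 -> I),
      exists h : vert G -> I,
      [/\ forall x, h (e1 x) = h1 x, forall x, h (e2 x) = h2 x
        & forall i P, adher P -> P (part h1 i) -> P (part h2 i) -> P (part h i)]].
Proof.
pose Gs b := if b then G1 else G2.
exists (dunion Gs), (fun x => @existT bool (fun b => vert (Gs b)) true x),
  (fun x => @existT bool (fun b => vert (Gs b)) false x); split.
- exact: (dunion_embedding Gs true).
- exact: (dunion_embedding Gs false).
- by move=> P [Pa _] P1 P2; apply: Pa => -[].
move=> I h1 h2.
pose hs b : vert (Gs b) -> I := if b as b0 return vert (Gs b0) -> I then h1 else h2.
exists (dunion_fun hs); split=> // i P PP P1 P2.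
by apply: adher_dunion_part => // -[].
Qed.

Lemma ordinal_copy H : exists n (G : hgraph_on C 'I_n)
    (e : vert H -> vert (HGraph G)) (e' : vert (HGraph G) -> vert H),
  [/\ embedding e, embedding e' & cancel e e'].
Proof.
pose E (s : seq 'I_#|vert H|) c := edge H (map enum_val s) c.
have wf s c : E s c -> 2 <= size s /\ uniq s.
  by move=> /edge_wf[]; rewrite size_map (map_inj_uniq enum_val_inj).
have fin : exists l : seq (seq 'I_#|vert H| * C), forall s c, E s c -> (s, c) \in l.
  have [cs Hcs] := edge_colours H.
  by apply: (@uniq_edge_fin _ _ _ cs) => s c e; split;
    [have [] := wf s c e|apply: Hcs e].
exists #|vert H|, (HGraphOn wf fin), enum_rank, enum_val; split.
- split=> [|s c]; first exact: enum_rank_inj.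
  by rewrite /= /E -map_comp (eq_map enum_rankK) map_id.
- by split=> [|s c]; [exact: enum_val_inj|].
exact: enum_rankK.
Qed.

(** The limit runs over [A]-coloured hypergraphs under colour-preserving embeddings. Each is
    coloured by pairs, its given colour and its colour under the [W] of [refine_colouring]; [R i j]
    is the limit class of the pair [(i, j)]. *)
Lemma exists_refinement (I J : finType) (A : I -> hgraph C -> Prop)
    (B : J -> hgraph C -> Prop) :
    (forall i, adher (A i)) -> (forall j, adher (B j)) ->
    (forall H, composite A H -> composite B H) ->
  exists R, refines A B R.
Proof.
move=> AA BB AB.
(* All hypergraphs together form a type in a universe too large for the
   ultrafilter lemma, hence the restriction to vertex sets ['I_k]. *)
pose T := {n : nat & {G : hgraph_on C 'I_n &
  {h : vert (HGraph G) -> I | forall i, A i (part h i)}}}.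
pose Gt (t : T) : hgraph C := HGraph (projT1 (projT2 t)).
pose ht (t : T) : vert (Gt t) -> I := sval (projT2 (projT2 t)).
have htA (t : T) i : A i (part (ht t) i) := svalP (projT2 (projT2 t)) i.
pose le (d t : T) := exists e : vert (Gt d) -> vert (Gt t),
  embedding e /\ forall x, ht t (e x) = ht d x.
have mkT G (h : vert G -> I) : (forall i, A i (part h i)) ->
    exists (t : T) (e : vert G -> vert (Gt t)),
      embedding e /\ forall x, ht t (e x) = h x.
  move=> Ah; have [n [G' [e [e' [Ee Ee' eK]]]]] := ordinal_copy G.
  have Ah' i : A i (part (h \o e') i).
    exact: (proj2 (AA i)) (emb_part_comp h i Ee') (Ah i).
  exists (existT _ n (existT _ G' (exist _ _ Ah'))), e; split=> // x.
  by rewrite /ht /= eK.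
have [|d0 _] := mkT (K0 C) (fun x => match x with end).
  by move=> i; apply: adher_empty => // -[[]].
have dir (d1 d2 : T) : exists d, forall t, le d t -> le d1 t /\ le d2 t.
  have [G [e1 [e2 [E1 E2 _ Hh]]]] := dunion2 (Gt d1) (Gt d2).
  have [h [h1 h2 Ph]] := Hh I (ht d1) (ht d2).
  have [|d [e' [Ee' eh']]] := mkT G h; first by move=> i; apply: Ph.
  exists d => t [e [Ee eh]].
  split; [exists (e \o (e' \o e1))|exists (e \o (e' \o e2))];
    (split; [by do 2!apply: embedding_comp => //|by move=> x /=; rewrite eh eh']).
have lerefl d : exists t, le d t.
  by exists d, id; split=> //; split=> // s c; rewrite map_id.
have [U [Ule US UI UE UC]] := @exists_ultrafilter T T le d0 dir lerefl.
have Wt (t : T) := boolp.cid (refine_colouring AA BB AB (htA t)).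
pose w (t : T) (x : vert (Gt t)) : I * J := (ht t x, sval (Wt t) x).
exists (fun i j => limit_class w U (i, j)); split.
- by move=> i j; apply: limit_adher.
- move=> i F AF.
  (* Coloured constantly by [i], a copy of [F] is itself an index, so [F] embeds with first colour
     [i] in almost all [Gt t]. *)
  have Fh i' : A i' (part (fun _ : vert F => i) i').
    have [<-|ne] := eqVneq i i'; first exact: (proj2 (AA i)) (emb_induced _) AF.
    by apply: adher_empty => // x; rewrite -[i'](part_ival x) eqxx in ne.
  have [d [e0 [Ee0 eh0]]] := mkT _ _ Fh; have /US UF := Ule d.
  have [|c [ci Hc]] := limit_split (w := w) US UI UE UC (F := F)
      (D := fun k => k.1 = i).
    apply: UF => t [e [Ee eh]]; exists (e \o e0).
    split=> [|x]; last by rewrite /= eh eh0.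
    exact: embedding_comp.
  exists (snd \o c) => j; apply: (proj2 (limit_adher w US UI UC (i, j))) (Hc (i, j)).
  apply: (emb_part (ival_embedding _)) => x.
  by rewrite [LHS]surjective_pairing ci -[in RHS](part_ival x).
(* With [j] as second colour throughout, [F] is, for some [t], a blowup of [Gt t] over vertices
   where [W] is [j]. It is then a blowup for [ht t] alone, and the choice of [W] gives [B j F]. *)
move=> j F [h Hh].
have [|t [L [l [p [bl wp]]]]] :=
    limit_blowup (w := w) US UI UE UC (H := F) (c := fun x => (h x, j)).
  move=> [i j']; have [<-|ne] := eqVneq j j'; last first.
    apply: adher_empty (limit_adher w US UI UC (i, j')) _ => x.
    by have [_ e] := part_ival x; rewrite e eqxx in ne.
  apply: (proj2 (limit_adher w US UI UC (i, j))) (Hh i).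
  apply: (emb_part (ival_embedding _)) => x.
  by have [] := part_ival x.
apply: (svalP (Wt t)) (l) (p) _ _; last by move=> v; have [] := wp v.
have [lpi pe] := bl; split=> // s c hs; apply: pe => x y xs ys.
by rewrite /= !wp; have [<- _] := wp x; have [<- _] := wp y; congr pair; apply: hs.
Qed.

End CommonRefinement.

(** * Strict hypergraphs and decompositions *)

Section Strict.
Variable C : eqType.
Implicit Types (F G H : hgraph C) (P Q : hgraph C -> Prop).

(** If the colour [i] did not occur, the vertex added in a member of [G * K1] could always receive
    it, and all of [G * K1] would lie in [P]. *)
Lemma strict_colouring_surj (I : finType) (Z : I -> hgraph C -> Prop) P G
    (h : vert G -> I) i :
    (forall i, adher (Z i)) -> (forall H, composite Z H -> P H) ->
    strict P G -> (forall i, Z i (part h i)) -> Z i (K1 C) ->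
  exists x, h x = i.
Proof.
move=> ZZ ZP [_ nj] Hh Zi; apply: boolp.contrapT => ni; apply: nj => E EJ.
apply: ZP.
pose hs (b : bool) : vert (if b then G else K1 C) -> I :=
  if b as b0 return vert (if b0 then G else K1 C) -> I then h else fun _ => i.
exists (fun z => hs (tag z) (tagged z)) => i'.
have [<-|ne] := eqVneq i i'.
  apply: (proj2 (ZZ i)) Zi; apply: emb_to_K1 => x y; apply: ival_inj.
  move: (part_ival x) (part_ival y).
  case: (ival x) => -[] /= u; first by move=> hu; case: ni; exists u.
  case: (ival y) => -[] /= v; first by move=> _ hv; case: ni; exists v.
  by case: u v => -[].
apply: (proj2 (ZZ i')) (Hh i').
have e : @embedding C G (HGraph E)
    (@existT bool (fun b => vert (if b then G else K1 C)) true).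
  split=> [x y e|s c]; first exact: (existT_inj e).
  by apply: iff_sym; apply: (EJ true).
apply: (emb_of_surj (embedding_comp (ival_embedding [set x | h x == i']) e)).
move=> [[] x]; rewrite inE /= => /eqP; last by move=> ii; rewrite ii eqxx in ne.
by move=> hx; have [|y <-] := ival_surj (U := [set x | h x == i']) (x := x);
  [rewrite inE hx | exists y].
Qed.

(** A new vertex takes the role of [v]: attaching it to the copy of [F] minus [v] in [H] along the
    edges of [F] through [v] gives a member of [H * K1] containing [F]. *)
Lemma strict_of_forbidden P F H (v : vert F)
    (e : vert (part (fun x => x == v) false) -> vert H) :
  adher P -> P H -> ~ P F -> embedding e -> strict P H.
Proof.
move=> PP PH nF Ee; split=> // jP; apply: nF.
pose V := {b : bool & vert (if b then H else K1 C)}.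
pose up (x : vert H) : V := @existT bool (fun b => vert (if b then H else K1 C)) true x.
pose pt : V := @existT bool (fun b => vert (if b then H else K1 C)) false tt.
have up_inj : injective up by move=> x y eq_xy; exact: (existT_inj eq_xy).
have [g Hg] := glue (c := fun x : vert F => x == v)
  (fun b => if b as b0 return vert (part (fun x => x == v) b0) -> V
            then fun _ => pt else fun y => up (e y)).
have gv : g v = pt.
  have [|y <-] := ival_surj (U := [set x | (x == v) == true]) (x := v).
    by rewrite inE eqxx.
  exact: (Hg true y).
have gup x : x != v -> exists y : vert (part (fun x => x == v) false),
    ival y = x /\ g x = up (e y).
  move=> xv; have [|y <-] := ival_surj (U := [set x | (x == v) == false]) (x := x).
    by rewrite inE (negbTE xv).
  by exists y; split=> //; exact: (Hg false y).
have g_inj : injective g.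
  move=> x y; have [->|/gup[x' [<- ->]]] := eqVneq x v.
    by have [->//|/gup[y' [_ ->]]] := eqVneq y v; rewrite gv.
  have [->|/gup[y' [<- ->]]] := eqVneq y v; first by rewrite gv.
  by move=> /up_inj /(proj1 Ee) ->.
have notv s : v \notin s -> exists t : seq (vert (part (fun x => x == v) false)),
    s = map (@ival C _ _) t /\ map g s = map up (map e t).
  move=> vs; have [|t st] := seq_ival (U := [set x | (x == v) == false]) (s := s).
    by move=> x xs; rewrite inE; apply/eqP/negbTE; apply: contraNneq vs => <-.
  exists t; split=> //; rewrite st -!map_comp; apply: eq_map => y.
  exact: (Hg false y).
pose E (s : seq V) (c : C) := (exists t, s = map up t /\ edge H t c) \/
  (exists t, [/\ s = map g t, edge F t c & v \in t]).
have wf s c : E s c -> 2 <= size s /\ uniq s.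
  case=> [[t [-> /edge_wf]]|[t [-> /edge_wf]]]; rewrite size_map map_inj_uniq //.
have fin : exists l : seq (seq V * C), forall s c, E s c -> (s, c) \in l.
  have [cs Hcs] := edge_colours F; have [cs' Hcs'] := edge_colours H.
  apply: (@uniq_edge_fin _ _ _ (cs ++ cs')) => s c Es.
  split; first by have [] := wf s c Es.
  by rewrite mem_cat; case: Es => [[t [_ /Hcs' ->]]|[t [_ /Hcs ->]]] //; rewrite orbT.
apply: (proj2 PP) (jP (HGraphOn wf fin) _).
  exists g; split=> // s c; split=> [es|].
    have [vs|/notv[t [st ->]]] := boolP (v \in s); first by right; exists s.
    left; exists (map e t); split=> //; apply/(proj2 Ee).
    by move: es; rewrite st.
  case=> [[t [st et]]|[t [st et _]]]; last by rewrite (inj_map g_inj st).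
  have /notv[t' [st' gt']] : v \notin s.
    apply/negP => /(map_f g); rewrite gv st => /mapP[x _ //].
  rewrite st'; apply/(proj2 Ee (t') c).
  by rewrite -(inj_map up_inj (etrans (esym st) gt')).
move=> [] s c; split=> [|es].
- case=> [[t [st et]]|[t [st et vt]]]; first by rewrite (inj_map up_inj st).
  have : pt \in map g t by rewrite -gv map_f.
  by rewrite -st => /mapP[].
- by left; exists s.
- move=> /(@edge_neq _ _ (HGraphOn wf fin)) [x [y [/mapP[x' _ ->] /mapP[y' _ ->]]]].
  by case: x' y' => -[]; rewrite eqxx.
- by case: es.
Qed.

(** Deleting a vertex from a smallest forbidden [F] leaves a member of [P]; its disjoint union with
    [G] is strict. *)
Lemma exists_strict P : adher P -> (exists H, ~ P H) ->
  forall G, P G -> exists H, strict P H /\ emb G H.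
Proof.
move=> PP [F0 nF0] G PG.
pose bad n := boolp.asbool (exists F, ~ P F /\ #|vert F| = n).
have exbad : exists n, bad n by exists #|vert F0|; apply/boolp.asboolP; exists F0.
case: (ex_minnP exbad) => n /boolp.asboolP[F [nF Fn]] minF.
have [v _] : exists v : vert F, True.
  apply: boolp.contrapT => nv; apply: nF; apply: adher_empty => // x.
  by apply: nv; exists x.
pose F1 := part (fun x => x == v) false.
have PF1 : P F1.
  apply: boolp.contrapT => nF1.
  have : n <= #|vert F1| by apply: minF; apply/boolp.asboolP; exists F1.
  rewrite leqNgt -Fn card_sig => /negP; apply.
  rewrite -cardsT; apply: proper_card; rewrite properE; apply/andP; split.
    by apply/subsetP=> x; rewrite inE.
  by apply/subsetPn; exists v; rewrite !inE ?eqxx.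
have [H [e1 [e2 [E1 E2 PH _]]]] := dunion2 G F1.
exists H; split; last by exists e1.
by apply: strict_of_forbidden E2 => //; apply: PH.
Qed.

(** For surjective [h] and [adher P], this says that the classes of [h] form a P-decomposition;
    every multiplicity [k] is covered because [L] is arbitrary. *)
Definition blow_closed P G (I : eqType) (h : vert G -> I) : Prop :=
  forall H (L : finType) (l : vert H -> L) (p : vert H -> vert G),
    blowup h l p -> P H.

Lemma composite_blow_closed (I : finType) (Z : I -> hgraph C -> Prop) P G
    (h : vert G -> I) :
  (forall i, adher (Z i)) -> (forall H, composite Z H -> P H) ->
  (forall i, Z i (part h i)) -> blow_closed P h.
Proof.
move=> ZZ ZP Hh H L l p bl; apply: ZP; exists (h \o p) => i.
exact: (blowup_comp ZZ Hh bl).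
Qed.

(** A coarser colouring has fewer blowups, so parts of a decomposition may be merged. *)
Lemma blow_closed_finer P G (I J : eqType) (h : vert G -> I) (h' : vert G -> J) :
  (forall x y, h x = h y -> h' x = h' y) -> blow_closed P h -> blow_closed P h'.
Proof.
by move=> hh' hP H L l p /(blowup_finer hh') /hP.
Qed.

Lemma copies_edgeE k G (U : {set vert G}) (s : seq (vert (copies k (induced U)))) c :
  edge (copies k (induced U)) s c <->
  const_on (fun z => tag z) s /\ edge G (map (fun z => ival (tagged z)) s) c.
Proof.
split=> [[i [t [-> et]]]|[ts es]].
  by rewrite const_on_map -map_comp.
case: s ts es => [_ /edge_nil//|x s] ts es.
have [|t st] := seq_tag (s := x :: s) (i := tag x).
  by move=> y ys; apply: ts => //; apply: mem_head.
by exists (tag x), t; split=> //; move: es; rewrite st -map_comp.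
Qed.

Lemma decomposition_of_blow_closed P G n (h : vert G -> 'I_n) :
  (forall i, exists x, h x = i) -> blow_closed P h ->
  decomposition P (fun i => [set x | h x == i]).
Proof.
move=> hs hP; split.
- split=> [i j ij|].
    rewrite -setI_eq0; apply/eqP/setP=> x; rewrite !inE.
    by apply/negP=> /andP[/eqP-> /eqP e]; rewrite e eqxx in ij.
  by apply/setP=> x; rewrite !inE; apply/bigcupP; exists (h x); rewrite ?inE.
- by move=> i; have [x hx] := hs i; apply/set0Pn; exists x; rewrite inE hx.
move=> k _ E EJ.
pose l (z : vert (HGraph E)) : 'I_k := tag (tagged z).
pose p (z : vert (HGraph E)) : vert G := ival (tagged (tagged z)).
have hp z : h (p z) = tag z by case: z => i [a x]; apply: (part_ival x).
apply: (hP (HGraph E) _ l p); split.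
  move=> z z' [lz pz]; have tz : tag z = tag z' by rewrite -!hp pz.
  case: z z' lz pz tz => i [a x] [i' [a' x']]; rewrite /l /p /= => lz pz tz.
  by move: x' pz; rewrite -tz -lz => x' /ival_inj ->.
move=> [|z s] c; first by split=> [/edge_nil|[_ /edge_nil]].
move=> zs; have [|t st] := seq_tag (s := z :: s) (i := tag z).
  by move=> y ys; rewrite -!hp; apply: zs => //; apply: mem_head.
rewrite st const_on_map -map_comp; have := EJ (tag z) t c => e.
apply: iff_trans e _; exact: copies_edgeE.
Qed.

(** Take [#|L|] copies of each part. Adding to their disjoint union the edges of the blowup that
    meet several parts gives a member of the join containing the blowup. *)
Lemma blow_closed_of_decomposition P G n (Vs : 'I_n -> {set vert G}) :
  adher P -> decomposition P Vs ->
  exists h : vert G -> 'I_n, (forall i, exists x, h x = i) /\ blow_closed P h.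
Proof.
move=> PP [[Vd VT] Vn Vj].
have /fin_all_exists[h Hh] (x : vert G) : exists i, x \in Vs i.
  have : x \in \bigcup_i Vs i by rewrite VT inE.
  by case/bigcupP=> i _ xi; exists i.
exists h; split=> [i|H L l p [lpi pe]].
  have /set0Pn[x xi] := Vn i; exists x; apply/eqP/negPn/negP => ne.
  by have /disjointFr/(_ (Hh x)) := Vd _ _ ne; rewrite xi.
(* The null case is separate because the number of copies, [#|L|], has to be positive. *)
have [[x0 _]|H0] := boolp.EM (exists x : vert H, True); last first.
  by apply: adher_empty => // x; apply: H0; exists x.
pose Gs i := copies #|L| (induced (Vs i)).
pose e (x : vert H) : vert (dunion Gs) := existT _ (h (p x)) (existT _ (enum_rank (l x))
  (exist (fun y => y \in Vs (h (p x))) (p x) (Hh (p x)))).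
pose pr (z : vert (dunion Gs)) : vert G := ival (tagged (tagged z)).
have e_inj : injective e.
  move=> x y exy; apply: lpi; congr pair; last exact: (congr1 pr exy).
  apply: enum_rank_inj; exact: (congr1 (fun z => tag (tagged z)) exy).
pose E (s : seq (vert (dunion Gs))) c := edge (dunion Gs) s c \/
  (exists t, [/\ s = map e t, edge H t c & ~ const_on (h \o p) t]).
have wf s c : E s c -> 2 <= size s /\ uniq s.
  by case=> [/edge_wf//|[t [-> /edge_wf]]]; rewrite size_map map_inj_uniq.
have fin : exists E' : seq (seq (vert (dunion Gs)) * C),
    forall s c, E s c -> (s, c) \in E'.
  have [cs Hcs] := edge_colours (dunion Gs); have [cs' Hcs'] := edge_colours H.
  apply: (@uniq_edge_fin _ _ _ (cs ++ cs')) => s c Es.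
  split; first by have [] := wf s c Es.
  by rewrite mem_cat; case: Es => [/Hcs ->|[t [_ /Hcs' -> _]]] //; rewrite orbT.
have L0 : 0 < #|L| by apply/card_gt0P; exists (l x0).
have EJ : in_join (HGraphOn wf fin).
  move=> i s c; apply: iff_sym; split=> [es|].
    by left; apply/(proj2 (dunion_embedding Gs i)).
  case=> [/(proj2 (dunion_embedding Gs i))//|[t [st et []]]] x y xt yt.
  have tE z : z \in t -> h (p z) = i.
    by move=> /(map_f e); rewrite -st => /mapP[u _ /(congr1 (fun z => tag z))].
  by rewrite /= !tE.
apply: (proj2 PP) (Vj _ L0 _ EJ).
exists e; split=> // s c.
have [cs|ncs] := boolp.EM (const_on (h \o p) s); last first.
  split=> [es|]; first by right; exists s.
  case=> [[i [t [st _]]]|[t [st et _]]]; last by rewrite (inj_map e_inj st).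
  case: ncs => x y xs ys; have tE z : z \in s -> h (p z) = i.
    by move=> /(map_f e); rewrite st => /mapP[u _ /(congr1 (fun z => tag z))].
  by rewrite /= !tE.
have -> : edge (HGraph (HGraphOn wf fin)) (map e s) c <-> edge (dunion Gs) (map e s) c.
  split=> [|es]; last by left.
  by case=> // -[t [st _ nt]]; rewrite (inj_map e_inj st) in cs.
rewrite pe //; case: s cs => [|x s] cs; first by split=> [[_ /edge_nil]|/edge_nil].
have [|t st] := seq_tag (s := map e (x :: s)) (i := h (p x)).
  by move=> _ /mapP[y ys ->]; apply: cs => //; apply: mem_head.
rewrite [in X in _ <-> X]st -(proj2 (dunion_embedding Gs (h (p x)))) copies_edgeE.
have -> : map p (x :: s) = map (fun z => ival (tagged z)) t.
  by have /(congr1 (map pr)) := st; rewrite -!map_comp.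
suff -> : const_on (fun z => tag z) t <-> const_on l (x :: s) by [].
have <- : const_on (fun z : vert (dunion Gs) => tag (tagged z)) (map e (x :: s)) <->
          const_on (fun z => tag z) t by rewrite st const_on_map.
rewrite const_on_map; split=> le y z ys zs; last by rewrite /= (le y z).
by apply: enum_rank_inj; apply: le.
Qed.

End Strict.

(** * Factorising into dec(P) classes, and counting factors *)

Section DecompositionNumber.
Variables (C : eqType) (P : hgraph C -> Prop).
Hypotheses (PP : adher P) (P1 : P (K1 C)).
Implicit Types (F G H : hgraph C).

Lemma composite_unit H : composite (fun _ : unit => P) H <-> P H.
Proof.
split=> [[c Hc]|PH]; last by apply: (@composite_incl _ _ _ tt).
by apply: (proj2 PP) (Hc tt); apply: emb_part_all => v; case: (c v).
Qed.

Lemma strict_inhab G : strict P G -> exists x : vert G, True.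
Proof.
move=> sG; have [|x _] := strict_colouring_surj (Z := fun _ : unit => P) (i := tt)
  (h := fun _ => tt) (fun _ => PP) (fun H => (composite_unit H).1) sG _ P1.
  by move=> i; apply: (proj2 PP) (emb_induced _) (proj1 sG).
by exists x.
Qed.

Lemma decomposition_size G n (Vs : 'I_n -> {set vert G}) :
  decomposition P Vs -> n <= #|vert G|.
Proof.
move=> /(blow_closed_of_decomposition PP) [h [/fin_all_exists[g gK] _]].
by rewrite -[X in X <= _]card_ord; apply: (@leq_card _ _ g); apply: (can_inj (g := h)).
Qed.

Lemma decomposition1 G : strict P G ->
  exists Vs : 'I_1 -> {set vert G}, decomposition P Vs.
Proof.
move=> sG; have [x _] := strict_inhab sG.
exists (fun i => [set x | (fun _ : vert G => ord0) x == i]).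
apply: decomposition_of_blow_closed; first by move=> i; exists x; rewrite [i]ord1.
apply: (@blow_closed_finer _ _ _ _ _ (fun _ => tt)) => //.
apply: (@composite_blow_closed _ _ (fun _ : unit => P)) => //.
  by move=> H /composite_unit.
by move=> i; apply: (proj2 PP) (emb_induced _) (proj1 sG).
Qed.

Lemma exists_dec_graph G : strict P G -> exists m, dec_graph P G m.
Proof.
move=> sG.
pose D n := boolp.asbool (exists Vs : 'I_n -> {set vert G}, decomposition P Vs).
have exD : exists n, D n by exists 1; apply/boolp.asboolP/decomposition1.
have ubD n : D n -> n <= #|vert G|.
  by move/boolp.asboolP => [Vs /decomposition_size].
case: (ex_maxnP exD ubD) => m /boolp.asboolP Dm maxm; exists m; split.
  by move=> _; split=> // n Vs dV; apply: maxm; apply/boolp.asboolP; exists Vs.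
by have [PG _] := sG.
Qed.

Hypothesis proper : exists H, ~ P H.

Lemma exists_dec : exists n, dec P n.
Proof.
pose D n := boolp.asbool (exists G, strict P G /\ dec_graph P G n).
have exD : exists n, D n.
  have [G [sG _]] := exists_strict PP proper P1.
  by have [m dm] := exists_dec_graph sG; exists m; apply/boolp.asboolP; exists G.
case: (ex_minnP exD) => n /boolp.asboolP Dn minn; exists n; split=> // G m sG dG.
by apply: minn; apply/boolp.asboolP; exists G.
Qed.

Variable n : nat.
Hypothesis decn : dec P n.

Lemma dec_gt0 : 0 < n.
Proof.
have [[G [sG dG]] _] := decn; have [Vs dV] := decomposition1 sG.
exact: ((dG.1 sG.1).2 _ _ dV).
Qed.

(** A strict hypergraph containing [G] has a P-decomposition with at least [n] parts; surplus parts
    are merged. *)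
Lemma exists_large_decomposition G : P G -> exists H (h : vert H -> 'I_n),
  [/\ emb G H, forall i, exists x, h x = i & blow_closed P h].
Proof.
move=> PG; have [H [sH GH]] := exists_strict PP proper PG.
have [m dm] := exists_dec_graph sH; have nm := decn.2 _ _ sH dm.
have [[Vs dV] _] := dm.1 sH.1.
have [h [hs hP]] := blow_closed_of_decomposition PP dV.
(* [minn i n.-1] sends all parts from index [n.-1] on to the last of the [n] parts, which exists
   since [n] is positive. *)
have n0 := dec_gt0; have min_lt i : minn i n.-1 < n.
  by rewrite (leq_ltn_trans (geq_minr _ _)) // prednK.
pose g (i : 'I_m) : 'I_n := Ordinal (min_lt i).
exists H, (g \o h); split=> // [i|]; last first.
  by apply: blow_closed_finer hP => x y /= ->.
have [x hx] := hs (widen_ord nm i); exists x; apply: val_inj.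
rewrite /= hx /=; apply/minn_idPl.
by rewrite -ltnS prednK.
Qed.

(** The factors are limit classes over hypergraphs decomposed into exactly [n] parts, which are
    cofinal in [P] by [exists_large_decomposition]. *)
Lemma exists_factorisation : exists Ps : 'I_n -> hgraph C -> Prop,
  [/\ forall i, adher (Ps i), forall i, Ps i (K1 C)
    & forall H, P H <-> composite Ps H].
Proof.
(* All hypergraphs together form a type in a universe too large for the
   ultrafilter lemma, hence the restriction to vertex sets ['I_k]. *)
pose T := {k : nat & {G : hgraph_on C 'I_k & {h : vert (HGraph G) -> 'I_n |
  (forall i, exists x, h x = i) /\ blow_closed P h}}}.
pose Gt (t : T) : hgraph C := HGraph (projT1 (projT2 t)).
pose ht (t : T) : vert (Gt t) -> 'I_n := sval (projT2 (projT2 t)).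
have htP (t : T) : (forall i, exists x, ht t x = i) /\ blow_closed P (ht t)
  := svalP (projT2 (projT2 t)).
pose D := {G | P G}.
pose le (d : D) (t : T) := emb (sval d) (Gt t).
have d0 : D by exists (K1 C).
have dir (d1 d2 : D) : exists d, forall t, le d t -> le d1 t /\ le d2 t.
  have [G [e1 [e2 [E1 E2 PG _]]]] := dunion2 (sval d1) (sval d2).
  have {}PG : P G by apply: PG; [|exact: svalP|exact: svalP].
  exists (exist _ G PG) => t; rewrite /le /= => Gte.
  by split; apply: emb_trans Gte; [exists e1|exists e2].
have lex d : exists t, le d t.
  have [H [h [GH hs hP]]] := exists_large_decomposition (svalP d).
  have [k [H' [e [e' [Ee Ee' eK]]]]] := ordinal_copy H.
  have hP' : (forall i, exists x, (h \o e') x = i) /\ blow_closed P (h \o e').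
    split=> [i|F L l p [lpi pe]].
      by have [x <-] := hs i; exists (e x); rewrite /= eK.
    apply: (hP F L l (e' \o p)); split.
      by move=> x y [lxy /(proj1 Ee') pxy]; apply: lpi; rewrite lxy pxy.
    by move=> s c hc; rewrite map_comp -(proj2 Ee'); apply: pe.
  exists (existT _ k (existT _ H' (exist _ _ hP'))).
  by apply: emb_trans GH _; exists e.
have [U [Ule US UI UE UC]] := @exists_ultrafilter D T le d0 dir lex.
exists (limit_class ht U); split.
- by move=> i; apply: limit_adher.
- move=> i; apply: US (Ule d0) => t _.
  have [x hx] := (htP t).1 i; exists unit, (fun _ => tt), (fun _ => x); split=> //.
    by move=> [] [].
  move=> s c; split=> [[]|[_ /edge_neq[y [z []]]]].
  by move=> /mapP[_ _ ->] /mapP[_ _ ->]; rewrite eqxx.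
move=> H; split=> [PH|[c /(limit_blowup US UI UE UC)]].
  have [|c [_ Hc]] := limit_split (w := ht) US UI UE UC (F := H) (D := fun _ => True).
    by apply: US (Ule (exist _ H PH)) => t [e Ee]; exists e.
  by exists c.
by move=> [t [L [l [p [/(htP t).2]]]]].
Qed.

Section FixedFactorisation.
Variables (K : finType) (Z : K -> hgraph C -> Prop).
Hypotheses (ZZ : forall k, adher (Z k)) (PZ : forall H, P H <-> composite Z H).

(** Take a strict [G] with decomposition number [n]. Its colouring by the [Z k] uses every
    nontrivial [Z k], and the classes form a decomposition. *)
Lemma card_factors : #|[set k | boolp.asbool (Z k (K1 C))]| <= n.
Proof.
have [[G [sG dG]] _] := decn; have [h Hh] := (PZ G).1 sG.1.
pose N := {k | boolp.asbool (Z k (K1 C))}.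
have hN x : boolp.asbool (Z (h x) (K1 C)).
  by apply/boolp.asboolP; apply: (colour_K1 x ZZ Hh).
pose h' x : 'I_#|{: N}| := enum_rank (exist _ (h x) (hN x) : N).
have -> : #|[set k | boolp.asbool (Z k (K1 C))]| = #|{: N}|.
  by rewrite card_sig; apply: eq_card => k; rewrite inE.
apply: ((dG.1 sG.1).2 _ (fun i => [set x | h' x == i])).
apply: decomposition_of_blow_closed.
  move=> i; have /boolp.asboolP Zk := svalP (enum_val i).
  have [|x hx] := strict_colouring_surj ZZ _ sG Hh Zk; first by move=> H /PZ.
  by exists x; apply: enum_val_inj; rewrite enum_rankK; apply: val_inj.
apply: (@blow_closed_finer _ _ _ _ _ h).
  by move=> x y hxy; congr enum_rank; apply: val_inj.
by apply: composite_blow_closed Hh => // H /PZ.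
Qed.

(** At most [n] nontrivial indices map onto [n] elements, so [f] is injective on them. *)
Lemma factors_proj_inj (I : finType) (f : K -> I) : #|I| = n ->
    (forall i, exists k, Z k (K1 C) /\ f k = i) ->
  forall k k', Z k (K1 C) -> Z k' (K1 C) -> f k = f k' -> k = k'.
Proof.
move=> In fs; set N := [set k | boolp.asbool (Z k (K1 C))].
have NP k : Z k (K1 C) -> k \in N by rewrite inE => /boolp.asboolP.
have fN : f @: N = [set: I].
  by apply/setP=> i; rewrite inE; have [k [/NP kN <-]] := fs i; apply: imset_f.
have /imset_injP finj : #|f @: N| == #|N|.
  by rewrite eqn_leq leq_imset_card fN cardsT In card_factors.
by move=> k k' /NP kN /NP kN'; apply: finj.
Qed.

End FixedFactorisation.

Section Refinements.
Variables (I J : finType) (A : I -> hgraph C -> Prop) (B : J -> hgraph C -> Prop).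
Variable R : I -> J -> hgraph C -> Prop.
Hypotheses (A1 : forall i, A i (K1 C)).
Hypotheses (BB : forall j, adher (B j)) (B1 : forall j, B j (K1 C)).
Hypotheses (PA : forall H, P H <-> composite A H).
Hypotheses (PB : forall H, P H <-> composite B H).
Hypothesis refAB : refines A B R.

Lemma refines_composite H : P H <-> composite (fun ij => R ij.1 ij.2) H.
Proof.
have [RR AR RB] := refAB; split=> [/PA|]; first exact: composite_flatten.
by move=> HR; apply/PB; apply: composite_group2 HR.
Qed.

Lemma refines_row i : exists j, R i j (K1 C).
Proof.
have [RR AR _] := refAB; have [c Hc] := AR i _ (A1 i).
by exists (c tt); apply: (colour_K1 (tt : vert (K1 C)) (RR i) Hc).
Qed.

(** Grouping by columns turns a colouring of a strict hypergraph by the [R i j] into one by the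
    [B j], which must use the colour [j]. *)
Lemma refines_col j : exists i, R i j (K1 C).
Proof.
have [RR AR RB] := refAB; have [[G [sG _]] _] := decn.
have [h Hh] := (refines_composite G).1 sG.1.
have Bh j' : B j' (part (snd \o h) j').
  apply: RB; exists (fun y => (h (ival y)).1) => i.
  apply: (proj2 (RR i j')) (Hh (i, j')).
  apply: (emb_part (embedding_comp (ival_embedding _) (ival_embedding _))) => x.
  rewrite /= [LHS]surjective_pairing; congr (_, _).
    exact: (part_ival x).
  exact: (part_ival (ival x)).
have [|x <-] := strict_colouring_surj BB _ sG Bh (B1 j); first by move=> H /PB.
by exists (h x).1; apply: (colour_K1 x (fun ij => RR ij.1 ij.2) Hh).
Qed.

(** Each of the [n] rows has a nontrivial entry, and there are at most [n] such entries in all. *)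
Lemma refines_row_inj i j j' : #|I| = n -> R i j (K1 C) -> R i j' (K1 C) -> j = j'.
Proof.
move=> In Rj Rj'; have [RR _ _] := refAB.
have rows i0 : exists k : I * J, R k.1 k.2 (K1 C) /\ k.1 = i0.
  by have [j0 Rj0] := refines_row i0; exists (i0, j0).
by case: (factors_proj_inj (fun ij => RR ij.1 ij.2) refines_composite In rows
  (k := (i, j)) (k' := (i, j')) Rj Rj' erefl).
Qed.

Lemma refines_col_inj i i' j : #|J| = n -> R i j (K1 C) -> R i' j (K1 C) -> i = i'.
Proof.
move=> Jn Rj Rj'; have [RR _ _] := refAB.
have cols j0 : exists k : I * J, R k.1 k.2 (K1 C) /\ k.2 = j0.
  by have [i0 Ri0] := refines_col j0; exists (i0, j0).
by case: (factors_proj_inj (fun ij => RR ij.1 ij.2) refines_composite Jn cols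
  (k := (i, j)) (k' := (i', j)) Rj Rj' erefl).
Qed.

End Refinements.

End DecompositionNumber.

(** * Irreducibility and uniqueness *)

Section Uniqueness.
Variable C : eqType.
Implicit Types (F G H : hgraph C) (P Q : hgraph C -> Prop).

Definition restrict_family (I : finType) (D : pred I) (A : I -> hgraph C -> Prop)
    (i : I) : hgraph C -> Prop :=
  if D i then A i else @null_class C.

Lemma restrict_family_adher (I : finType) (D : pred I) (A : I -> hgraph C -> Prop) i :
  (forall i, adher (A i)) -> adher (restrict_family D A i).
Proof.
move=> AA; rewrite /restrict_family.
by case: (D i) => //; apply: null_class_adher.
Qed.

Lemma null_K1 : ~ null_class (K1 C).
Proof. by apply. Qed.

Lemma restrict_family_K1 (I : finType) (D : pred I) (A : I -> hgraph C -> Prop) i :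
  restrict_family D A i (K1 C) -> D i.
Proof. by rewrite /restrict_family; case: (D i) => // /null_K1. Qed.

Lemma restrict_family_split (I : finType) (D : pred I) (A : I -> hgraph C -> Prop) i0 :
    (forall i, adher (A i)) -> D i0 ->
  forall F, composite (restrict_family D A) F <->
  composite (fun b : bool => if b then A i0 else
    composite (restrict_family (fun i => D i && (i != i0)) A)) F.
Proof.
move=> AA D0 F; set D' := (fun i : I => D i && (i != i0)).
(* A matrix with two columns: [A i0] alone in column [true], the other factors in column [false].
   Its rows compose to the left side, its columns to the right side. *)
pose Z i (b : bool) := if b then restrict_family (pred1 i0) A i
                       else restrict_family D' A i.
have ZZ i b : adher (Z i b) by case: b; apply: restrict_family_adher.
split.
  move=> /(@composite_flatten _ _ bool _ Z _ ZZ) HZ.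
  apply: (composite_group2 (Z := Z) ZZ); last apply: HZ.
    case=> H.
      move=> HZ'; have := @composite_single _ _ _ i0 _ _ _ HZ'.
      rewrite /Z /restrict_family /= eqxx; apply=> [i|i].
        by apply: (ZZ i true).
      by case: (i =P i0) => // _ /null_K1.
    exact: composite_mono.
  move=> i H AH.
  have [ii|ni] := eqVneq i i0.
    apply: (@composite_incl _ _ _ true) => //; rewrite /Z /restrict_family /= ii eqxx.
    by move: AH; rewrite ii /restrict_family D0.
  apply: (@composite_incl _ _ _ false) => //; rewrite /Z /restrict_family /D' ni andbT.
  exact: AH.
pose Z' b i := Z i b.
have ZZ' b i : adher (Z' b i) := ZZ i b.
move=> /(@composite_flatten _ _ I _ Z' _ ZZ') HZ.
apply: (composite_group2 (Z := Z') ZZ'); last apply: HZ.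
  move=> i H HZ'; have [ii|ni] := eqVneq i i0.
    have := @composite_single _ _ _ true _ _ _ HZ'.
    rewrite /Z' /Z /restrict_family /D' ii /= eqxx D0 andbF; apply=> [[]|[]//].
    - exact: AA.
    - exact: null_class_adher.
    - by move/null_K1.
  have := @composite_single _ _ _ false _ _ _ HZ'.
  rewrite /Z' /Z /restrict_family /D' /= (negbTE ni) andbT; apply=> [[]|[]//].
  - exact: null_class_adher.
  - by have := ZZ i false; rewrite /Z /restrict_family /D' ni andbT.
  - by move/null_K1.
case=> H AH; last exact: AH.
apply: (@composite_incl _ _ _ i0) => //.
by rewrite /Z' /Z /restrict_family /= eqxx.
Qed.

(** The inclusions run round the finite cycle of [f] through [i], so they are equalities. *)
Lemma iter_incl_eq (I : finType) (A : I -> hgraph C -> Prop) (f : I -> I) :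
    injective f -> (forall i F, A i F -> A (f i) F) ->
  forall i F, A (f i) F -> A i F.
Proof.
move=> fi Af i F.
have up k j : A j F -> A (iter k f j) F by elim: k => //= k IH /IH /Af.
move=> /(up (fingraph.order f i).-1); rewrite -iterSr prednK ?fingraph.order_gt0 //.
by rewrite fingraph.iter_order.
Qed.

Section Irreducible.
Variable P : hgraph C -> Prop.
Variable n : nat.
Hypothesis decn : dec P n.
Variable A : 'I_n -> hgraph C -> Prop.
Hypotheses (AA : forall i, adher (A i)) (A1 : forall i, A i (K1 C)).
Hypothesis PA : forall H, P H <-> composite A H.

(** Replacing a reducible factor by its two factors would give more than [n] nontrivial factors. *)
Lemma factor_irreducible i : irreducible (A i).
Proof.
split=> [|[Q1 [Q2 [/add_ind_herE[QQ1 Q11] /add_ind_herE[QQ2 Q21] AQ]]]].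
  exact/add_ind_herE.
pose Z i' (b : bool) := if i' == i then if b then Q1 else Q2
  else if b then A i' else @null_class C.
have ZZ i' b : adher (Z i' b).
  by rewrite /Z; case: eqP => _; case: b => //; apply: null_class_adher.
have AZ i' F : A i' F <-> composite (Z i') F.
  have [->|ne] := eqVneq i' i.
    rewrite (AQ F) /compose2 composeE /Z ?eqxx; first by [].
    by case.
  split=> [AF|].
    by apply: (@composite_incl _ _ _ true) => //; rewrite /Z (negbTE ne).
  move=> /(@composite_single _ _ _ true); rewrite {3}/Z (negbTE ne); apply=> // -[] //.
  by rewrite /Z (negbTE ne) => /null_K1.
have PZ H : P H <-> composite (fun k => Z k.1 k.2) H.
  rewrite PA; split; first by apply: composite_flatten => // i' F /AZ.
  by apply: composite_group1 => // i' F /AZ.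
have Zt i' : exists k : 'I_n * bool, Z k.1 k.2 (K1 C) /\ k.1 = i'.
  by exists (i', true); split=> //=; rewrite /Z; case: eqP.
have Zi b : Z i b (K1 C) by rewrite /Z eqxx; case: b.
by case: (factors_proj_inj decn (fun k => ZZ k.1 k.2) PZ (card_ord n) Zt
  (k := (i, true)) (k' := (i, false)) (Zi _) (Zi _) erefl).
Qed.

Section Comparison.
Variables (m : nat) (Q : 'I_m -> hgraph C -> Prop).
Hypotheses (QQ : forall j, adher (Q j)) (Q1 : forall j, Q j (K1 C)).
Hypothesis PQ : forall H, P H <-> composite Q H.

(** In a refinement of [A] against [Q], row [i] has a single nontrivial entry, which contains [A i];
    [f i] is its column. *)
Lemma fibres_below : exists f : 'I_n -> 'I_m, forall j F,
  composite (restrict_family (fun i => f i == j) A) F -> Q j F.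
Proof.
have [|R refR] := exists_refinement AA QQ; first by move=> H /PA /PQ.
have [RR AR RQ] := refR.
have /fin_all_exists[f Rf] i := refines_row A1 refR i.
exists f => j F Hc; apply: RQ; apply: composite_mono Hc => i G.
rewrite /restrict_family; case: eqP => [<-|_]; last exact: adher_empty.
move=> /AR; apply: composite_single => // j'.
move=> Rj'.
exact: (refines_row_inj decn A1 PA PQ refR (card_ord n) Rj' (Rf i)).
Qed.

(** Now [Q] is refined against [A]; column [i] has a single nontrivial entry, and [f i] is its
    row. *)
Lemma fibres_above : exists f : 'I_n -> 'I_m, forall j F,
  Q j F -> composite (restrict_family (fun i => f i == j) A) F.
Proof.
have [|R refR] := exists_refinement QQ AA; first by move=> H /PQ /PA.
have [RR QR RA] := refR.
have /fin_all_exists[f Rf] i := refines_col decn AA A1 PQ PA refR i.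
exists f => j F /QR; apply: composite_mono => i G RG.
rewrite /restrict_family; case: eqP => [_|nfi].
  by apply: RA; apply: (@composite_incl _ _ _ j).
move=> x; apply: nfi.
apply: (refines_col_inj decn AA A1 PQ PA refR (card_ord n) (Rf i)).
exact: adher_K1 RG x.
Qed.

(** The maps [f] and [g] from the two refinements may differ. Refining the fibres of [f] against
    those of [g] yields a permutation [t] with [g (t i) = f i] and [A (t i)] equal to [A i], which
    matches the fibres. *)
Lemma fibres_eq : exists f : 'I_n -> 'I_m, forall j F,
  Q j F <-> composite (restrict_family (fun i => f i == j) A) F.
Proof.
have [f Af] := fibres_below; have [g Ag] := fibres_above.
pose Af_ j := restrict_family (fun i => f i == j) A.
pose Ag_ j := restrict_family (fun i => g i == j) A.
have /fin_all_exists[R refR] j : exists R, refines (Af_ j) (Ag_ j) R.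
  apply: exists_refinement => [i|i|H /Af /Ag //]; exact: restrict_family_adher.
(* Row [i] comes from the refinement for its own fibre [f i], so that [S] refines [A] against
   itself. *)
pose S i i' := R (f i) i i'.
have S_null i i' F : f i != g i' -> S i i' F -> null_class F.
  move=> ne SF; have [RR _ RB] := refR (f i).
  have : Ag_ (f i) i' F by apply: RB; apply: (@composite_incl _ _ _ i).
  by rewrite /Ag_ /restrict_family eq_sym (negbTE ne).
have refS : refines A A S.
  split=> [i i'|i F AF|i' F Hc].
  - by have [RR _ _] := refR (f i); apply: RR.
  - by have [_ AR _] := refR (f i); apply: AR; rewrite /Af_ /restrict_family eqxx.
  have [RR _ RB] := refR (g i').
  have : Ag_ (g i') i' F; last by rewrite /Ag_ /restrict_family eqxx.
  apply: RB; apply: composite_mono Hc => i G SG.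
  have [<-//|ne] := eqVneq (f i) (g i').
  by apply: adher_empty => //; apply: S_null SG.
have [SS AS SA] := refS.
have /fin_all_exists[t St] i := refines_row A1 refS i.
have t_uniq i i' : S i i' (K1 C) -> i' = t i.
  by move=> Si; apply: (refines_row_inj decn A1 PA PA refS (card_ord n) Si (St i)).
(* Every column of [S] has a nontrivial entry too, so [t] is onto, hence injective. *)
have t_inj : injective t.
  have /fin_all_exists[u Su] i := refines_col decn AA A1 PA PA refS i.
  have utK : cancel u t by move=> i; rewrite -(t_uniq _ _ (Su i)).
  exact: (bij_inj (bij_can_bij (injF_bij (can_inj utK)) utK)).
have gt i : g (t i) = f i.
  apply/eqP; rewrite eq_sym; apply/negPn/negP => ne.
  exact: null_K1 (S_null _ _ _ ne (St i)).
have At i F : A i F -> A (t i) F.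
  move=> /AS HS; apply: SA; apply: (@composite_incl _ _ _ i) => //.
  by apply: composite_single HS => // i' /t_uniq.
have tA := iter_incl_eq t_inj At.
exists f => j F; split=> [/Ag[c Hc]|]; last exact: Af.
have [t' tK t'K] := injF_bij t_inj.
exists (t' \o c) => i; rewrite /restrict_family -gt.
have e : emb (part (t' \o c) i) (part c (t i)).
  apply: (emb_part (ival_embedding _)) => x.
  by rewrite -[in RHS](part_ival x) /= t'K.
have := Hc (t i); rewrite /restrict_family; case: (g (t i) == j) => Hti.
  exact/tA/(proj2 (AA _) _ _ e).
by move=> x; case: e => e' _; apply: Hti (e' x).
Qed.

(** Two indices in one fibre of [f] would make that [Q j] reducible, and an empty fibre would make
    it null; so [f] is bijective and each [Q j] is a single [A i]. *)
Lemma irreducible_factors_unique : (forall j, irreducible (Q j)) ->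
  exists f : 'I_m -> 'I_n, bijective f /\ forall j, same_class (Q j) (A (f j)).
Proof.
move=> Qirr; have [f Qf] := fibres_eq.
have f_inj : injective f.
  move=> i1 i2 fi; apply/eqP/negPn/negP => ne.
  have [_ []] := Qirr (f i1).
  set B := composite (restrict_family (fun i => (f i == f i1) && (i != i1)) A).
  have BB : adher B by apply: composite_adher => i; apply: restrict_family_adher.
  exists (A i1), B; split; [exact/add_ind_herE| |].
    apply/add_ind_herE; split=> //.
    apply: (@composite_incl _ _ _ i2) => [i|]; first exact: restrict_family_adher.
    by rewrite /restrict_family fi eqxx eq_sym ne.
  move=> F; rewrite Qf (restrict_family_split (i0 := i1)) // /compose2 composeE //.
  by case.
have f_surj j : exists i, f i = j.
  have [c Hc] := (Qf j _).1 (Q1 j); exists (c tt).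
  have := colour_K1 (tt : vert (K1 C)) (fun i => restrict_family_adher _ i AA) Hc.
  by move=> /restrict_family_K1 /eqP.
have /fin_all_exists[g fg] := f_surj.
exists g; split=> [|j F].
  by exists f => // i; apply: f_inj; rewrite fg.
rewrite Qf; split=> [|AF].
  move=> HA; have := @composite_single _ _ _ (g j) F _ _ HA.
  rewrite {3}/restrict_family fg eqxx; apply=> i; first exact: restrict_family_adher.
  by move=> /restrict_family_K1 /eqP ij; apply: f_inj; rewrite fg ij.
apply: (@composite_incl _ _ _ (g j)) => [i|]; first exact: restrict_family_adher.
by rewrite /restrict_family fg eqxx.
Qed.

End Comparison.
End Irreducible.
End Uniqueness.

Theorem theorem5 (C : eqType) (P : hgraph C -> Prop)
  (hP : add_ind_her P) (hproper : exists H : hgraph C, ~ P H) :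
  exists (n : nat) (Ps : 'I_n -> hgraph C -> Prop),
    [/\ irr_factorisation P Ps,
        dec P n
      & forall (m : nat) (Qs : 'I_m -> hgraph C -> Prop),
          irr_factorisation P Qs ->
          exists f : 'I_m -> 'I_n,
            bijective f /\ forall i, same_class (Qs i) (Ps (f i))].
Proof.
have [PP P1] := (add_ind_herE P).1 hP.
have [n decn] := exists_dec PP P1 hproper.
have [Ps [PsA Ps1 PPs]] := exists_factorisation PP P1 hproper decn.
exists n, Ps; split=> //.
  split; first by move=> i; apply: (factor_irreducible decn PsA Ps1 PPs).
  by move=> H; rewrite PPs composeE.
move=> m Qs [Qirr PQ].
have QA i : adher (Qs i) by have [/add_ind_herE[]] := Qirr i.
have Q1 i : Qs i (K1 C) by have [/add_ind_herE[]] := Qirr i.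
apply: (irreducible_factors_unique decn PsA Ps1 PPs QA Q1) => // H.
by rewrite PQ composeE.
Qed.
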